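(* Let $K$ be a complete discretely valued field of odd residue characteristic $p$. Let $E_1/K: y^2=c_1f_1(x)$ and $E_2/K: y^2=c_2f_2(x)$ be elliptic curves with $c_1,c_2\in K^\times$ and $f_1,f_2\in K[x]$ monic polynomials of degree $3$, and let $\mathcal R_1,\mathcal R_2\subset\overline K$ be the sets of roots of $f_1$ and $f_2$ respectively. Suppose that: (1) $c_1/c_2\in K^{\times 2}$; (2) there is a $G_K$-equivariant bijection $\phi:\mathcal R_1\to\mathcal R_2$ such that $$\frac{\phi(r)-\phi(s)}{r-s}\in 1+\mathfrak m_{\overline K}$$ for all distinct $r,s\in\mathcal R_1$. Then $T_2E_1\cong T_2E_2$ as $\mathbb Z_2[G_K]$-modules.
   Context: $K$ is a complete discretely valued field with valuation ring $\mathcal O_K$, uniformiser $\pi$ and odd residue characteristic $p$. $\overline K$ is an algebraic closure of $K$, $v$ is the extension of the valuation of $K$ to $\overline K$, normalised by $v(\pi)=1$, and $\mathfrak m_{\overline K}=\{x\in\overline K: v(x)>0\}$. $G_K$ is the absolute Galois group of $K$. $K^{\times 2}$ denotes the group of squares in $K^\times$. $T_2E=\varprojlim_n E[2^n]$ (with $E[2^n]=E(\overline K)[2^n]$ and transition maps multiplication by $2$) is the integral $2$-adic Tate module with its natural $G_K$-action. *)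

(* Defs.v *)
From HB Require Import structures.
From mathcomp Require Import all_boot all_order all_algebra.
From mathcomp Require Import mathcomp_extra boolp classical_sets functions.
From mathcomp Require Import constructive_ereal.

Set Implicit Arguments.
Unset Strict Implicit.
Unset Printing Implicit Defensive.

Import Order.TTheory GRing.Theory Num.Theory.
Local Open Scope classical_set_scope.
Local Open Scope ring_scope.

(* Values in rat suffice: the value group of an algebraic extension of a field
   with value group Z embeds in rat. *)
Record valuation (F : fieldType) := Valuation {
  val_fun :> F -> \bar rat;
  val_neq_ninfty : forall x, val_fun x <> -oo%E;
  val_pinfty : forall x, val_fun x = +oo%E <-> x = 0;
  val_mul : forall x y, val_fun (x * y)%R = (val_fun x + val_fun y)%E;
  val_add : forall x y,
    (Order.min (val_fun x) (val_fun y) <= val_fun (x + y)%R)%E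
}.

Definition maximal_ideal (F : fieldType) (v : valuation F) : set F :=
  [set x | (0%:E < v x)%E].

(* The value group is exactly Z and varpi is a uniformiser. *)
Definition normalised_discrete (F : fieldType) (v : valuation F) (varpi : F) :=
  v varpi = 1%:E /\
  forall x : F, x != 0 -> exists n : int, v x = (n%:~R)%:E.

Definition val_cauchy (F : fieldType) (v : valuation F) (u : nat -> F) :=
  forall N : nat, exists n0 : nat, forall m n : nat,
    (n0 <= m)%N -> (n0 <= n)%N -> ((N%:R)%:E <= v (u m - u n)%R)%E.

Definition val_converges (F : fieldType) (v : valuation F) (u : nat -> F)
    (l : F) :=
  forall N : nat, exists n0 : nat, forall n : nat,
    (n0 <= n)%N -> ((N%:R)%:E <= v (u n - l)%R)%E.

Definition val_complete (F : fieldType) (v : valuation F) :=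
  forall u : nat -> F, val_cauchy v u -> exists l : F, val_converges v u l.

(* p = 0 in the residue field, i.e. the image of p in O / m vanishes. *)
Definition residue_char (F : fieldType) (v : valuation F) (p : nat) :=
  prime p /\ maximal_ideal v p%:R.

Section Galois.
Variables (K : fieldType) (L : closedFieldType) (iota : {rmorphism K -> L}).

Definition algebraic_closure := forall x : L, algebraicOver iota x.

Definition val_extends (v : valuation K) (w : valuation L) :=
  forall x : K, w (iota x) = v x.

(* Aut(L / K) is the absolute Galois group also when K is imperfect: restriction
   to the separable closure is an isomorphism. *)
Definition abs_galois (sigma : {rmorphism L -> L}) :=
  bijective sigma /\ forall a : K, sigma (iota a) = iota a.

End Galois.

(* The plane cubic y^2 = c f(x). *)
Record cubic_eqn (F : fieldType) := CubicEqn { ccst : F; cpol : {poly F} }.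

Definition base_change (F F' : fieldType) (i : {rmorphism F -> F'})
    (E : cubic_eqn F) : cubic_eqn F' :=
  CubicEqn (i (ccst E)) (map_poly i (cpol E)).

Section GroupLaw.
Variables (F : fieldType) (E : cubic_eqn F).
Local Notation c := (ccst E).
Local Notation f := (cpol E).

(* None is the point at infinity. *)
Definition ec_point := option (F * F).

Definition on_curve (P : ec_point) : bool :=
  if P is Some (x, y) then y ^+ 2 == c * f.[x] else true.

(* Jacobian criterion at the points of the affine chart with coordinates in F;
   when f is a monic cubic the point at infinity is always smooth. *)
Definition nonsingular := forall x y : F, on_curve (Some (x, y)) ->
  ~ (2%:R * y = 0 /\ c * f^`().[x] = 0).

(* The line of slope l through (x1, y1) and (x2, _) meets the curve in three
   points whose abscissas sum to l^2 / c - f`_2. *)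
Definition ec_third (l x1 y1 x2 : F) : ec_point :=
  let x3 := l ^+ 2 / c - f`_2 - x1 - x2 in
  Some (x3, - (y1 + l * (x3 - x1))).

Definition ec_add (P Q : ec_point) : ec_point :=
  match P, Q with
  | None, _ => Q
  | _, None => P
  | Some (x1, y1), Some (x2, y2) =>
      if x1 == x2 then
        if y1 == - y2 then None
        else ec_third (c * f^`().[x1] / (2%:R * y1)) x1 y1 x2
      else ec_third ((y2 - y1) / (x2 - x1)) x1 y1 x2
  end.

Definition ec_mul (n : nat) (P : ec_point) : ec_point :=
  iter n (ec_add P) None.

Definition ec_torsion (n : nat) : set ec_point :=
  [set P | on_curve P /\ ec_mul n P = None].

Definition tate2 : set (nat -> ec_point) :=
  [set t | forall n : nat,
     ec_torsion (2 ^ n) (t n) /\ ec_mul 2 (t n.+1) = t n].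

End GroupLaw.

(* Z_2 as the inverse limit of the Z / 2^n; a class is represented by its
   residue in [0, 2^n). *)
Definition Z2_int : set (nat -> nat) :=
  [set a | forall n : nat, a n = (a n.+1 %% 2 ^ n)%N].

Definition gal_point (L : fieldType) (sigma : L -> L) (P : ec_point L) :
    ec_point L :=
  omap (fun xy => (sigma xy.1, sigma xy.2)) P.

(* All operations on the Tate modules are termwise on sequences of points. A
   Z_2[G_K]-linear map is an additive map commuting with the actions of Z_2 and
   of G_K. *)
Definition tate2_isomorphic (K : fieldType) (L : closedFieldType)
    (iota : {rmorphism K -> L}) (E1 E2 : cubic_eqn K) :=
  let E1L := base_change iota E1 in
  let E2L := base_change iota E2 in
  exists h : (nat -> ec_point L) -> (nat -> ec_point L),
  [/\ set_bij (tate2 E1L) (tate2 E2L) h,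
      forall s t, tate2 E1L s -> tate2 E1L t ->
        h (fun n => ec_add E1L (s n) (t n)) =
        (fun n => ec_add E2L (h s n) (h t n)),
      forall a t, Z2_int a -> tate2 E1L t ->
        h (fun n => ec_mul E1L (a n) (t n)) =
        (fun n => ec_mul E2L (a n) (h t n)) &
      forall (sigma : {rmorphism L -> L}) t,
        abs_galois iota sigma -> tate2 E1L t ->
        h (fun n => gal_point sigma (t n)) =
        (fun n => gal_point sigma (h t n))].

(* y^2 = c f(x), with f a monic cubic, is an elliptic curve over K: it is smooth
   over the algebraic closure. *)
Definition elliptic (K : fieldType) (L : closedFieldType)
    (iota : {rmorphism K -> L}) (c : K) (f : {poly K}) :=
  [/\ c != 0, f \is monic, size f = 4%N &
      nonsingular (base_change iota (CubicEqn c f))].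

Definition geom_roots (K : fieldType) (L : closedFieldType)
    (iota : {rmorphism K -> L}) (f : {poly K}) : set L :=
  [set r | root (map_poly iota f) r].

(* Main.v *)
(* Write a ~ b when b / a lies in 1 + m. A point P = (x, y) of E1 is matched with
   P' = (x', y') of E2 when x - r ~ x' - phi(r) for each root r and y ~ u y', where
   c1 = u^2 c2. Halving P amounts to extracting square roots a_i of the x - r_i, the
   half having abscissa r_1 + (a_1 + a_2)(a_1 + a_3). Since 2 is a unit, square roots
   lift uniquely along ~, and so does a_i + a_j because
   (a_i + a_j)(a_i - a_j) = r_j - r_i ~ phi(r_j) - phi(r_i). So every half of P is
   matched with a half of P', and by induction every 2-power torsion point of E1 has
   a match on E2.
   The match is unique among torsion points: two points of one curve that are
   matched by the identity differ by a point at which all x - r have valuation below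
   those of the differences of roots, and doubling preserves these valuations, so
   such a point is not torsion. The same fact controls the differences of abscissas
   x(P) - x(Q) of torsion points, and then the addition formulas show that the
   matching is additive. It commutes with Galois because the valuation of a complete
   field extends uniquely to its algebraic closure, by the equivalence of norms on a
   finite-dimensional space.
   Associativity of the group law comes from the class group of the coordinate ring. *)
Require Import Defs.
From HB Require Import structures.
From mathcomp Require Import all_boot all_order all_algebra.
From mathcomp Require Import mathcomp_extra boolp classical_sets functions.
From mathcomp Require Import constructive_ereal.
From mathcomp Require Import ring lra.

Set Implicit Arguments.
Unset Strict Implicit.
Unset Printing Implicit Defensive.

Import Order.TTheory GRing.Theory Num.Theory.
Local Open Scope classical_set_scope.
Local Open Scope ring_scope.

(** * The group law *)

(** The obstacle throughout is that ~ is multiplicative and says nothing about a sum in which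
    cancellation occurs. Every sum in the addition formulas has to be exhibited as free of
    cancellation, or as a factor of a product whose other factors are known up to ~. Congruence of
    the coordinates modulo m would not do instead, since the equations need not be integral or
    minimal, whereas ~ is unaffected by scaling. Compatibility with doubling costs little: halves of
    matched points are matched, and uniqueness reverses this. The work in general additivity lies in
    the ordinates, above the roots r, of the line through P and Q: a formula for their squares would
    leave signs undetermined. Associativity matters because the uniqueness argument subtracts
    torsion points and needs the difference to be torsion. On the class group side, points act on
    arbitrary ideals and ideals are compared up to regular multipliers, so that neither products of
    ideals nor a fraction field appear. The group axioms are pulled back from ideal classes along an
    injective map, injectivity being the fact that the ideal of an affine point is not principal. *)

Section PointIdeals.
Variables (F : fieldType) (A : comNzRingType) (k : {rmorphism F -> A}) (X Y : A).
Variables (c a b d : F).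
Hypothesis c_neq0 : c != 0.
Hypothesis curve_eq : Y ^+ 2 = k c * (X ^+ 3 + k a * X ^+ 2 + k b * X + k d).
Hypothesis two_neq0 : 2%:R != 0 :> F.
Hypothesis X_reg : forall x, GRing.lreg (X - k x).

Definition ideal (J : set A) :=
  (forall u v, J u -> J v -> J (u + v)) /\ (forall r u, J u -> J (r * u)).

(* The product of J with the ideal (X - x, Y - y) of the point (x, y). *)
Definition point_mul (P : option (F * F)) (J : set A) : set A :=
  if P is Some (x, y) then
    [set w | exists j j', [/\ J j, J j' & w = j * (X - k x) + j' * (Y - k y)]]
  else J.

Definition scale_ideal (r : A) (J : set A) : set A := [set r * j | j in J].

(** Equality of ideal classes: I and J differ by the principal fractional ideal of s / r, written
    without fractions. *)
Definition ideal_equiv (I J : set A) :=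
  exists r s, [/\ GRing.lreg r, GRing.lreg s & scale_ideal r I = scale_ideal s J].

Lemma point_mul_ideal P J : ideal J -> ideal (point_mul P J).
Proof.
case: P => [[x y]|] // [JD JM]; split.
  move=> u v [j [j' [Jj Jj' ->]]] [i [i' [Ji Ji' ->]]].
  by exists (j + i), (j' + i'); split; [exact: JD|exact: JD|ring].
move=> r u [j [j' [Jj Jj' ->]]].
by exists (r * j), (r * j'); split; [exact: JM|exact: JM|ring].
Qed.

Lemma point_mulC P Q J : ideal J ->
  point_mul P (point_mul Q J) = point_mul Q (point_mul P J).
Proof.
suff sub P' Q' : ideal J ->
    point_mul P' (point_mul Q' J) `<=` point_mul Q' (point_mul P' J).
  by move=> HJ; apply/seteqP; split; exact: sub.
case: P' => [[x y]|]; last by move=> _ w.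
case: Q' => [[x' y']|] [JD JM] w; last by apply.
move=> [u [u' [[j [j' [Jj Jj' ->]]] [i [i' [Ji Ji' ->]]] ->]]].
exists (j * (X - k x) + i * (Y - k y)), (j' * (X - k x) + i' * (Y - k y)); split.
- by exists j, i.
- by exists j', i'.
- by ring.
Qed.

Lemma point_mul_scale r P J :
  point_mul P (scale_ideal r J) = scale_ideal r (point_mul P J).
Proof.
case: P => [[x y]|] //; apply/seteqP; split => w.
  move=> [_ [_ [[j Jj <-] [j' Jj' <-] ->]]].
  by exists (j * (X - k x) + j' * (Y - k y)); [exists j, j'|ring].
move=> [_ [j [j' [Jj Jj' ->]]] <-].
by exists (r * j), (r * j'); split; [exists j|exists j'|ring].
Qed.

Lemma scale_idealM r s J :
  scale_ideal r (scale_ideal s J) = scale_ideal (r * s) J.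
Proof.
apply/seteqP; split => w.
  by move=> [_ [j Jj <-] <-]; exists j; rewrite ?mulrA.
by move=> [j Jj <-]; exists (s * j); [exists j|rewrite mulrA].
Qed.

Lemma ideal_equiv_refl I : ideal_equiv I I.
Proof. by exists 1, 1; split => //; exact: lreg1. Qed.

Lemma ideal_equiv_sym I J : ideal_equiv I J -> ideal_equiv J I.
Proof. by move=> [r [s [? ? ?]]]; exists s, r; split. Qed.

Lemma ideal_equiv_trans I J H :
  ideal_equiv I J -> ideal_equiv J H -> ideal_equiv I H.
Proof.
move=> [r [s [rr rs rIsJ]]] [r' [s' [rr' rs' rJsH]]].
exists (r' * r), (s * s'); split; [exact: lregM|exact: lregM|].
by rewrite -!scale_idealM rIsJ -rJsH !scale_idealM mulrC.
Qed.

Lemma ideal_equiv_point_mul P I J :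
  ideal_equiv I J -> ideal_equiv (point_mul P I) (point_mul P J).
Proof.
move=> [r [s [rr rs rIsJ]]]; exists r, s; split => //.
by rewrite -!point_mul_scale rIsJ.
Qed.

(** With (Y - y)(Y + y) = (X - x) q, the product of the two point ideals is X - x times the ideal
    generated by X - x, Y - y, Y + y and q. The latter is the whole ring: it contains 2y, and q is
    congruent to c f'(x) modulo X - x, so smoothness provides a nonzero constant. *)
Lemma point_mul_opp x y J : ideal J ->
  y ^+ 2 = c * (x ^+ 3 + a * x ^+ 2 + b * x + d) ->
  ~ (2%:R * y = 0 /\ c * (3%:R * x ^+ 2 + 2%:R * a * x + b) = 0) ->
  point_mul (Some (x, y)) (point_mul (Some (x, - y)) J) =
    scale_ideal (X - k x) J.
Proof.
move=> [JD JM] on smooth.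
pose q := k c * (X ^+ 2 + X * k x + k x ^+ 2 + k a * (X + k x) + k b).
have /(congr1 k) := on; rewrite !(rmorphM, rmorphD, rmorphXn) /= => on'.
have etaM : (Y - k y) * (Y + k y) = (X - k x) * q.
  by rewrite /q; ring: curve_eq on'.
apply/seteqP; split => w.
  move=> [u [u' [[j [j' [Jj Jj' ->]]] [i [i' [Ji Ji' ->]]] ->]]].
  exists ((j * (X - k x) + j' * (Y - k (- y))) + (i * (Y - k y) + i' * q)).
    have JMr r u0 : J u0 -> J (u0 * r) by rewrite mulrC; apply: JM.
    by apply: (JD); apply: (JD); apply: JMr.
  by rewrite rmorphN /q; ring: curve_eq on'.
have [TD TM] : ideal (point_mul (Some (x, y)) (point_mul (Some (x, - y)) J)).
  by do 2!apply: point_mul_ideal.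
(* The empty set also satisfies [ideal], so 0 is obtained from an actual member. *)
have J0 j : J j -> J 0 by move/(JM 0); rewrite mul0r.
have mem j1 j2 j3 j4 : J j1 -> J j2 -> J j3 -> J j4 ->
   point_mul (Some (x, y)) (point_mul (Some (x, - y)) J)
     ((j1 * (X - k x) + j2 * (Y - k (- y))) * (X - k x) +
      (j3 * (X - k x) + j4 * (Y - k (- y))) * (Y - k y)).
  move=> J1 J2 J3 J4; exists (j1 * (X - k x) + j2 * (Y - k (- y))).
  exists (j3 * (X - k x) + j4 * (Y - k (- y))).
  by split => //; [exists j1, j2|exists j3, j4].
move=> [j Jj <-]; have Jj0 := J0 _ Jj.
have [y0|y_neq0] := eqVneq y 0.
  have g'_neq0 : c * (3%:R * x ^+ 2 + 2%:R * a * x + b) != 0.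
    by apply/eqP => g'0; apply: smooth; rewrite y0 mulr0.
  pose g' := c * (3%:R * x ^+ 2 + 2%:R * a * x + b).
  have kg : k g'^-1 * k g' = 1 by rewrite -rmorphM mulVf ?rmorph1.
  (* The coefficients come from q - c f'(x) = c (X - x)(X + 2x + a). *)
  have -> : (X - k x) * j = k g'^-1 *
     ((- (k c * (X + 2%:R * k x + k a)) * j * (X - k x) +
        0 * (Y - k (- y))) * (X - k x) +
      (0 * (X - k x) + j * (Y - k (- y))) * (Y - k y)).
    have -> : (- (k c * (X + 2%:R * k x + k a)) * j * (X - k x) +
      0 * (Y - k (- y))) * (X - k x) +
      (0 * (X - k x) + j * (Y - k (- y))) * (Y - k y) = k g' * ((X - k x) * j).
      rewrite rmorphN /g' !(rmorphM, rmorphD, rmorphXn, rmorph_nat) /=.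
      by ring: curve_eq on'.
    by rewrite mulrA kg mul1r.
  by apply: TM; apply: mem => //; apply: JM.
have -> : (X - k x) * j = k (2%:R * y)^-1 *
     ((0 * (X - k x) + j * (Y - k (- y))) * (X - k x) +
      (- 1 * j * (X - k x) + 0 * (Y - k (- y))) * (Y - k y)).
  have kg : k (2%:R * y)^-1 * k (2%:R * y) = 1.
    by rewrite -rmorphM mulVf ?rmorph1 // mulf_neq0.
  have -> : (0 * (X - k x) + j * (Y - k (- y))) * (X - k x) +
      (- 1 * j * (X - k x) + 0 * (Y - k (- y))) * (Y - k y) =
      k (2%:R * y) * ((X - k x) * j).
    by rewrite rmorphN rmorphM rmorph_nat; ring.
  by rewrite mulrA kg mul1r.
by apply: TM; apply: mem => //; apply: JM.
Qed.

(* The line Y = L through P and Q meets the curve in a third point of abscissa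
   x3; the three hypotheses on l and x3 say that
   c f - L^2 = c (X - x1) (X - x2) (X - x3). Then (X - x3) I_P I_Q = (Y - L) I_(P + Q). *)
Lemma point_mul_add x1 y1 x2 y2 l x3 J : ideal J ->
  c * a = l ^+ 2 - c * (x1 + x2 + x3) ->
  c * b = 2%:R * l * (y1 - l * x1) + c * (x1 * x2 + x1 * x3 + x2 * x3) ->
  c * d = (y1 - l * x1) ^+ 2 - c * x1 * x2 * x3 ->
  y2 = y1 + l * (x2 - x1) ->
  x1 <> x2 \/ x1 = x2 /\ y1 <> 0 ->
  ideal_equiv (point_mul (Some (x1, y1)) (point_mul (Some (x2, y2)) J))
    (point_mul (Some (x3, - (y1 + l * (x3 - x1)))) J).
Proof.
move=> HJ /(congr1 k) e2 /(congr1 k) e1 /(congr1 k) e0 y2E generic.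
have [JD JM] := HJ; have JMr r u : J u -> J (u * r) by rewrite mulrC; exact: JM.
rewrite !(rmorphM, rmorphD, rmorphB, rmorphXn, rmorph_nat) /= in e2 e1 e0.
set xi1 := X - k x1; set xi2 := X - k x2; set xi3 := X - k x3.
set L := k y1 + k l * xi1.
have kc : k c^-1 * k c = 1 by rewrite -rmorphM mulVf ?rmorph1.
have normL : (Y - L) * (Y + L) = k c * xi1 * xi2 * xi3.
  have -> : (Y - L) * (Y + L) = Y ^+ 2 - L ^+ 2 by ring.
  by rewrite curve_eq !mulrDr !mulrA e2 e1 e0 /L /xi1 /xi2 /xi3; ring.
have norm3 : xi3 * xi1 * xi2 = k c^-1 * ((Y - L) * (Y + L)).
  by rewrite normL !mulrA kc; ring.
have etaS : Y - k (- (y1 + l * (x3 - x1))) = Y + L - k l * xi3.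
  by rewrite !(rmorphN, rmorphM, rmorphD, rmorphB) /= /L /xi1 /xi3; ring.
have eta1 : Y - k y1 = Y - L + k l * xi1 by rewrite /L; ring.
have eta2 : Y - k y2 = Y - L + k l * xi2.
  by rewrite y2E !(rmorphM, rmorphD, rmorphB) /= /L /xi1 /xi2; ring.
set T := point_mul (Some (x1, y1)) (point_mul (Some (x2, y2)) J).
have [TD TM] : ideal T by do 2!apply: point_mul_ideal.
have mem j1 j2 j3 j4 : J j1 -> J j2 -> J j3 -> J j4 ->
   T ((j1 * xi2 + j2 * (Y - k y2)) * xi1 +
      (j3 * xi2 + j4 * (Y - k y2)) * (Y - k y1)).
  move=> J1 J2 J3 J4; exists (j1 * xi2 + j2 * (Y - k y2)).
  exists (j3 * xi2 + j4 * (Y - k y2)).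
  by split => //; [exists j1, j2|exists j3, j4].
have JN j : J j -> J (- j) by move=> Jj; rewrite -mulN1r; apply: JM.
have J0 j : J j -> J 0 by move/(JM 0); rewrite mul0r.
have mem_xi j : J j -> T (j * xi1 * xi2).
  move=> Jj; have := mem j 0 0 0 Jj (J0 _ Jj) (J0 _ Jj) (J0 _ Jj).
  by congr T; ring.
have mem_line1 j : J j -> T (j * (Y - L) * xi1).
  move=> Jj; have := mem (- k l * j) j 0 0 (JM _ _ Jj) Jj (J0 _ Jj) (J0 _ Jj).
  by congr T; rewrite eta2; ring.
have mem_line2 j : J j -> T (j * (Y - L) * xi2).
  move=> Jj; have := mem (- k l * j) 0 j 0 (JM _ _ Jj) (J0 _ Jj) Jj (J0 _ Jj).
  by congr T; rewrite eta1; ring.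
(* For a chord, xi1 and xi2 differ by a nonzero constant. For a tangent, (Y + L) - (Y - L) = 2L is
   congruent modulo xi1 to the nonzero constant 2 y1. *)
have mem_line j : J j -> T (j * (Y - L)).
  have solve z u w : z != 0 -> u = k z * w -> T u -> T w.
    move=> z0 -> /(TM (k z^-1)).
    by rewrite mulrA -rmorphM mulVf // rmorph1 mul1r.
  move=> Jj; case: generic => [x12|[x12 y1_neq0]].
    apply: (solve (x1 - x2) (j * (Y - L) * xi2 + (- j) * (Y - L) * xi1)).
    - by rewrite subr_eq0; apply/eqP.
    - by rewrite rmorphB /= /xi1 /xi2; ring.
    - by apply: TD; [exact: mem_line2|apply: mem_line1; exact: JN].
  have xi12 : xi2 = xi1 by rewrite /xi2 -x12.
  have memL : T (j * (Y - L) * (Y - L)).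
    have := TD _ _ (mem 0 0 0 j (J0 _ Jj) (J0 _ Jj) (J0 _ Jj) Jj)
      (TD _ _ (mem_line1 _ (JM (- 2%:R * k l) _ Jj)) (mem_xi _ (JM (- k l ^+ 2) _ Jj))).
    by congr T; rewrite eta1 eta2 xi12; ring.
  have memLc : T (j * (Y - L) * (Y + L)).
    have := mem_xi _ (JM (k c * xi3) _ Jj).
    by congr T; rewrite -[RHS]mulrA normL; ring.
  apply: (solve (2%:R * y1)
    (j * (Y - L) * (Y + L) + - 1 * (j * (Y - L) * (Y - L)) +
      (- 2%:R * k l * j) * (Y - L) * xi1)).
  - by rewrite mulf_neq0 //; apply/eqP.
  - by rewrite rmorphM rmorph_nat /L; ring.
  - apply: (TD); last by apply: mem_line1; apply: JM.
    by apply: (TD) => //; apply: TM.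
exists xi3, (Y - L); split; first exact: X_reg.
  (* Y - L is regular because it divides a product of regular elements. *)
  move=> u v /(congr1 ( *%R (k c^-1 * (Y + L)))).
  have norm_reg : GRing.lreg (xi3 * xi1 * xi2) by do !apply: lregM; exact: X_reg.
  have conj_mul w : k c^-1 * (Y + L) * ((Y - L) * w) = xi3 * xi1 * xi2 * w.
    by rewrite norm3; ring.
  by rewrite !conj_mul; exact: norm_reg.
apply/seteqP; split => w.
  move=> [_ [_ [_ [[j [j' [Jj Jj' ->]]] [i [i' [Ji Ji' ->]]] ->]]] <-].
  rewrite -/xi1 -/xi2 eta1 eta2 -/xi3.
  (* The given member of T is regrouped as A1 xi1 xi2 + B1 (Y - L). *)
  pose A1 := j + k l * i + k l * j' + k l ^+ 2 * i'.
  pose B1 := (j' + k l * i') * xi1 + (i * xi2 + i' * (Y - k y2)).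
  have JA1 : J A1 by do !apply: (JD) => //; apply: JM.
  have JB1 : J B1.
    apply: (JD); last by apply: (JD); apply: JMr.
    by apply: JMr; apply: (JD) => //; apply: JM.
  exists ((A1 * (k c^-1 * k l) + B1) * xi3 +
      (A1 * k c^-1) * (Y - k (- (y1 + l * (x3 - x1))))).
    exists (A1 * (k c^-1 * k l) + B1), (A1 * k c^-1); split => //.
      by apply: (JD) => //; apply: JMr.
    exact: JMr.
  rewrite etaS.
  transitivity (A1 * (xi3 * xi1 * xi2) + B1 * (Y - L) * xi3).
    by rewrite norm3; ring.
  by rewrite /A1 /B1 eta2; ring.
move=> [_ [m [m' [Jm Jm' ->]]] <-].
exists (k c * m' * xi1 * xi2 + (m - k l * m') * (Y - L)).
  apply: TD; first by apply: mem_xi; apply: JM.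
  by apply: mem_line; apply: (JD) => //; apply: JN; apply: JM.
rewrite etaS -/xi3.
transitivity (m' * (k c * xi1 * xi2 * xi3) + (m - k l * m') * (Y - L) * xi3).
  by ring.
by rewrite -normL; ring.
Qed.
End PointIdeals.

(* F[X, Y] / (Y^2 - g); (p, q) stands for p + q Y. *)
Definition coord_ring_of (F : fieldType) (g : {poly F}) : Type :=
  ({poly F} * {poly F})%type.

(** * The coordinate ring of the affine curve and its norm *)

Section CoordinateRing.
Variables (F : fieldType) (g : {poly F}).
Local Notation coord_ring := (coord_ring_of g).

HB.instance Definition _ :=
  GRing.Zmodule.copy coord_ring ({poly F} * {poly F})%type.

Definition coord_one : coord_ring := (1, 0).
Definition coord_mul (u v : coord_ring) : coord_ring :=
  (u.1 * v.1 + u.2 * v.2 * g, u.1 * v.2 + u.2 * v.1).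

Fact coord_mulA : associative coord_mul.
Proof. by move=> u v w; congr pair => /=; ring. Qed.
Fact coord_mulC : commutative coord_mul.
Proof. by move=> u v; congr pair => /=; ring. Qed.
Fact coord_mul1 : left_id coord_one coord_mul.
Proof. by move=> [u v]; congr pair => /=; ring. Qed.
Fact coord_mulDl : left_distributive coord_mul +%R.
Proof. by move=> u v w; congr pair => /=; ring. Qed.
Fact coord_one_neq0 : coord_one != 0.
Proof. by rewrite xpair_eqE oner_eq0. Qed.

HB.instance Definition _ := GRing.Zmodule_isComNzRing.Build coord_ring
  coord_mulA coord_mulC coord_mul1 coord_mulDl coord_one_neq0.

Definition coord_const (x : F) : coord_ring := (x%:P, 0).

Fact coord_const_is_additive : zmod_morphism coord_const.
Proof. by move=> x y; congr pair; rewrite /= ?polyCB ?subr0. Qed.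
Fact coord_const_is_multiplicative : monoid_morphism coord_const.
Proof.
by split=> [|x y]; congr pair => //=; rewrite ?polyCM ?(mul0r, mulr0, addr0).
Qed.
HB.instance Definition _ := GRing.isZmodMorphism.Build F coord_ring
  coord_const coord_const_is_additive.
HB.instance Definition _ := GRing.isMonoidMorphism.Build F coord_ring
  coord_const coord_const_is_multiplicative.

Definition coordX : coord_ring := ('X, 0).
Definition coordY : coord_ring := (0, 1).

Definition coord_norm (u : coord_ring) : {poly F} := u.1 ^+ 2 - u.2 ^+ 2 * g.

Lemma coord_normM u v : coord_norm (u * v) = coord_norm u * coord_norm v.
Proof. by rewrite /coord_norm /=; ring. Qed.

Lemma coordX_reg x : GRing.lreg (coordX - coord_const x).
Proof.
have X0 : 'X - x%:P != 0 by rewrite polyXsubC_eq0.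
move=> [p q] [p' q'] [/=]; rewrite !subr0 !mul0r !addr0.
by move=> /(mulfI X0) -> /(mulfI X0) ->.
Qed.

(** The degrees of p^2 and q^2 g have opposite parities, so their leading terms cannot cancel. *)
Lemma coord_norm_size u : size g = 4%N -> u.2 != 0 -> (4 <= size (coord_norm u))%N.
Proof.
case: u => p q /= size_g q_neq0.
have g_neq0 : g != 0 by rewrite -size_poly_gt0 size_g.
have q_gt0 : (0 < size q)%N by rewrite size_poly_gt0.
have size_q : size (q ^+ 2 * g) = (size q).*2.+2.
  rewrite size_mul ?expf_neq0 // size_g expr2 size_mul // addnn; move: q_gt0.
  by case: (size q) => //= n _; rewrite doubleS !addnS addn0.
have [->|p_neq0] := eqVneq p 0.
  rewrite /coord_norm expr0n /= sub0r size_polyN size_q.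
  by move: q_gt0; case: (size q) => // n _; rewrite doubleS.
have p_gt0 : (0 < size p)%N by rewrite size_poly_gt0.
have size_p : size (p ^+ 2) = (size p).*2.-1.
  by rewrite expr2 size_mul // addnn.
have size_q4 : (4 <= size (q ^+ 2 * g)%R)%N.
  by rewrite size_q; case: (size q) q_gt0 => // n _; rewrite doubleS.
have [le_pq|lt_qp] := ltnP (size (p ^+ 2)) (size (q ^+ 2 * g)).
  by rewrite /coord_norm /= addrC size_polyDl ?size_polyN.
have lt_qp' : (size (q ^+ 2 * g)%R < size (p ^+ 2)%R)%N.
  rewrite ltn_neqAle lt_qp andbT size_q size_p.
  apply/eqP => /(congr1 odd); case: (size p) p_gt0 => // n _.
  by rewrite doubleS /= !odd_double.
rewrite /coord_norm /= size_polyDl ?size_polyN //.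
exact: leq_trans size_q4 (ltnW lt_qp').
Qed.

(* The ideal of an affine point is not principal: the norm of a generator would
   divide (X - x)^2, hence be of degree at most 2, which leaves only constants. *)
Lemma point_ideal_not_principal x y : size g = 4%N -> y ^+ 2 = g.[x] ->
  ~ ideal_equiv (point_mul coord_const coordX coordY (Some (x, y)) setT) setT.
Proof.
move=> size_g on [r [s [rr _ rTs]]].
have TT j j' : point_mul coord_const coordX coordY (Some (x, y)) setT
    (j * (coordX - coord_const x) + j' * (coordY - coord_const y)).
  by exists j, j'.
have [w [j [j' [_ _ wE]]] rw] : scale_ideal r
    (point_mul coord_const coordX coordY (Some (x, y)) setT) s.
  by rewrite rTs; exists 1 => //; rewrite mulr1.
have gen z : point_mul coord_const coordX coordY (Some (x, y)) setT z ->
    exists t, z = w * t.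
  move=> Tz; have : scale_ideal s setT (r * z) by rewrite -rTs; exists z.
  by move=> [t _ /esym]; rewrite -rw -mulrA => /rr ->; exists t.
have [t tE] := gen _ (TT 1 0); have [t' t'E] := gen _ (TT 0 1).
rewrite mul1r mul0r addr0 in tE; rewrite mul0r mul1r add0r in t'E.
have normX : coord_norm w * coord_norm t = ('X - x%:P) ^+ 2.
  by rewrite -coord_normM -tE /coord_norm /= subr0 expr0n mul0r subr0.
have w2 : w.2 = 0.
  apply/eqP; apply: contraT => w2.
  have X2_neq0 : ('X - x%:P) ^+ 2 != 0 by rewrite expf_neq0 // polyXsubC_eq0.
  have : (size (coord_norm w) <= size (('X - x%:P) ^+ 2)%R)%N.
    by apply: dvdp_leq => //; rewrite -normX dvdp_mulIl.
  rewrite expr2 size_mul ?polyXsubC_eq0 // size_XsubC.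
  by move/(leq_trans (coord_norm_size size_g w2)).
have /(congr1 snd) /= := t'E; rewrite w2 subr0 mul0r addr0 => w1.
have w1_size : size w.1 = 1%N.
  by apply/eqP; rewrite -dvdp1 w1 dvdp_mulIl.
(* A generator belongs to the ideal of (x, y), hence vanishes at that point. The second component of
   [wE] at x eliminates j'. *)
have wx : w.1.[x] = 0.
  move/(congr1 snd): (wE); move/(congr1 fst): (wE); rewrite /= w2.
  rewrite !(subr0, mulr0, mul0r, addr0, mulr1) sub0r => w1E w2E.
  have /(congr1 (horner^~ x)) := w2E; have /(congr1 (horner^~ x)) := w1E.
  rewrite !(hornerD, hornerM, hornerN, hornerX, hornerC) /=.
  move: (j.1.[x]) (j.2.[x]) (j'.1.[x]) (j'.2.[x]) => ja jb ja' jb' -> e.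
  have -> : ja' = jb' * y.
    by apply/eqP; rewrite -subr_eq0; apply/eqP; rewrite [RHS]e; ring.
  rewrite -on.
  by ring.
have /size_poly1P[z z0 wz] : size w.1 == 1%N by rewrite w1_size.
by move: wx; rewrite wz hornerC => /eqP; rewrite (negbTE z0).
Qed.
End CoordinateRing.

(** * The group axioms from ideal classes, and 2-power torsion *)

Section GroupLaw.
Variables (F : fieldType) (E : cubic_eqn F).
Local Notation c := (ccst E).
Local Notation f := (cpol E).

Definition smooth_cubic :=
  [/\ 2%:R != 0 :> F, c != 0, f \is monic, size f = 4%N & nonsingular E].

Definition ec_neg (P : ec_point F) : ec_point F :=
  omap (fun xy => (xy.1, - xy.2)) P.

Hypothesis smooth : smooth_cubic.

Let two_neq0 : 2%:R != 0 :> F. Proof. by case: smooth. Qed.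
Let c_neq0 : c != 0. Proof. by case: smooth. Qed.

Lemma cubicE : f = 'X ^+ 3 + f`_2 *: 'X ^+ 2 + f`_1 *: 'X + (f`_0)%:P.
Proof.
have [_ _ /monicP lead_f size_f _] := smooth.
move: lead_f; rewrite /lead_coef size_f /= => f3.
rewrite -[LHS]coefK size_f poly_def !big_ord_recr big_ord0 /= f3 scale1r add0r.
by rewrite expr0 alg_polyC expr1; ring.
Qed.

Lemma horner_cubic x : f.[x] = x ^+ 3 + f`_2 * x ^+ 2 + f`_1 * x + f`_0.
Proof. by rewrite {1}cubicE !hornerE /=; ring. Qed.

Lemma horner_deriv_cubic x : f^`().[x] = 3%:R * x ^+ 2 + 2%:R * f`_2 * x + f`_1.
Proof.
rewrite {1}cubicE !derivD !derivZ derivC derivX !derivXn.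
by rewrite !(hornerD, hornerZ, hornerMn, hornerXn, hornerX, hornerC) /=; ring.
Qed.

(** Chord and tangent are treated alike: in both cases c f - (y1 + l (X - x1))^2 = c (X - x1)(X -
    x2)(X - x3), stated coefficient by coefficient as [point_mul_add] expects it. *)
Variant ec_add_spec x1 y1 x2 y2 : ec_point F -> Prop :=
| EcAddOpp of x1 = x2 & y1 = - y2 : ec_add_spec x1 y1 x2 y2 None
| EcAddThird l x3 of
    c * f`_2 = l ^+ 2 - c * (x1 + x2 + x3) &
    c * f`_1 = 2%:R * l * (y1 - l * x1) + c * (x1 * x2 + x1 * x3 + x2 * x3) &
    c * f`_0 = (y1 - l * x1) ^+ 2 - c * x1 * x2 * x3 &
    y2 = y1 + l * (x2 - x1) &
    x1 <> x2 \/ x1 = x2 /\ y1 <> 0 :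
    ec_add_spec x1 y1 x2 y2 (Some (x3, - (y1 + l * (x3 - x1)))).

Lemma ec_addP x1 y1 x2 y2 : on_curve E (Some (x1, y1)) ->
  on_curve E (Some (x2, y2)) ->
  ec_add_spec x1 y1 x2 y2 (ec_add E (Some (x1, y1)) (Some (x2, y2))).
Proof.
move=> /eqP; rewrite horner_cubic => on1 /eqP; rewrite horner_cubic => on2.
rewrite /ec_add; case: eqVneq => [x12|x12].
  case: eqVneq => [y12|y12]; first by constructor.
  have y1E : y2 = y1.
    have /eqP : (y1 - y2) * (y1 + y2) = 0 by rewrite -subr_sqr on1 on2 x12 subrr.
    rewrite mulf_eq0 subr_eq0 addr_eq0 (negbTE y12) orbF.
    by move/eqP.
  have y1_neq0 : y1 != 0.
    by apply: contra_neq y12 => y10; rewrite y1E y10 oppr0.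
  rewrite /ec_third horner_deriv_cubic -x12; set l := _ / (_ * y1); set x3 := _ - x1 - x1.
  have e1 : c * f`_1 = 2%:R * l * (y1 - l * x1) + c * (x1 * x1 + x1 * x3 + x1 * x3).
    by rewrite /x3 /l; field; rewrite c_neq0 y1_neq0 two_neq0.
  apply: EcAddThird => //.
  - by rewrite /x3; field.
  - have -> : c * f`_0 = y1 ^+ 2 - c * x1 ^+ 3 - c * f`_2 * x1 ^+ 2 - c * f`_1 * x1.
      by rewrite on1; ring.
    by rewrite e1 /x3; field.
  - by rewrite y1E; ring.
  - by right; split => //; apply/eqP.
rewrite /ec_third; set l := _ / (x2 - x1); set x3 := _ - x1 - x2.
have x21 : x2 - x1 != 0 by rewrite subr_eq0 eq_sym.
have yl : y2 = y1 + l * (x2 - x1) by rewrite /l; field.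
have e1 : c * f`_1 = 2%:R * l * (y1 - l * x1) + c * (x1 * x2 + x1 * x3 + x2 * x3).
  apply: (mulIf x21).
  have -> : c * f`_1 * (x2 - x1) =
    y2 ^+ 2 - y1 ^+ 2 - c * (x2 ^+ 3 - x1 ^+ 3) - c * f`_2 * (x2 ^+ 2 - x1 ^+ 2).
    by rewrite on1 on2; ring.
  by rewrite yl /x3; field.
apply: EcAddThird => //.
- by rewrite /x3; field.
- have -> : c * f`_0 = y1 ^+ 2 - c * x1 ^+ 3 - c * f`_2 * x1 ^+ 2 - c * f`_1 * x1.
    by rewrite on1; ring.
  by rewrite e1 /x3; field.
- by left; apply/eqP.
Qed.

Lemma ec_add_on_curve P Q : on_curve E P -> on_curve E Q -> on_curve E (ec_add E P Q).
Proof.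
case: P => [[x1 y1]|] //; case: Q => [[x2 y2]|] // onP onQ.
case: (ec_addP onP onQ) => //= l x3 e2 e1 e0 _ _.
rewrite horner_cubic !mulrDr !mulrA e2 e1 e0; apply/eqP; ring.
Qed.

Let g := c *: f.
Local Notation pm := (point_mul (coord_const g) (coordX g) (coordY g)).

Let size_g : size g = 4%N.
Proof. by rewrite size_scale //; case: smooth. Qed.

Let coord_curve : coordY g ^+ 2 = coord_const g c * (coordX g ^+ 3 +
  coord_const g f`_2 * coordX g ^+ 2 + coord_const g f`_1 * coordX g +
  coord_const g f`_0).
Proof.
rewrite !expr2 !exprS expr0; congr pair => /=; last by ring.
rewrite /g {1}cubicE -!mul_polyC; ring.
Qed.

Let setT_ideal : ideal [set: coord_ring_of g]. Proof. by []. Qed.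

(** Passing to ideal classes turns [ec_add] into multiplication. An arbitrary J allows iteration,
    which associativity requires. *)
Lemma point_mul_ec_add P Q J : on_curve E P -> on_curve E Q -> ideal J ->
  ideal_equiv (pm P (pm Q J)) (pm (ec_add E P Q) J).
Proof.
case: P => [[x1 y1]|]; last by move=> *; exact: ideal_equiv_refl.
case: Q => [[x2 y2]|]; last by move=> *; exact: ideal_equiv_refl.
move=> onP onQ HJ; case: (ec_addP onP onQ) => [x12 y12|l x3 e2 e1 e0 yl gen].
  have y2E : y2 = - y1 by rewrite y12 opprK.
  have [_ _ _ _ ns] := smooth.
  rewrite -x12 y2E (point_mul_opp coord_curve two_neq0 HJ).
  - exists 1, (coordX g - coord_const g x1).
    split; [exact: lreg1|exact: coordX_reg|].
    by rewrite scale_idealM mul1r.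
  - by move/eqP: onP; rewrite horner_cubic.
  - by rewrite -horner_deriv_cubic; exact: ns.
exact: (point_mul_add c_neq0 coord_curve two_neq0 (@coordX_reg _ g) HJ e2 e1 e0).
Qed.

Lemma ec_neg_on_curve P : on_curve E P -> on_curve E (ec_neg P).
Proof. by case: P => [[x y]|] //=; rewrite sqrrN. Qed.

Lemma ec_add_neg P : ec_add E P (ec_neg P) = None.
Proof. by case: P => [[x y]|] //=; rewrite eqxx opprK eqxx. Qed.

Lemma ec_sub_eq0 P Q : ec_add E P (ec_neg Q) = None -> P = Q.
Proof.
case: P => [[x y]|]; case: Q => [[x' y']|] //=.
by case: eqVneq => // ->; rewrite opprK; case: eqVneq => // ->.
Qed.

(** P - Q has trivial class, whereas an affine point has a non-principal ideal; hence P - Q is the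
    point at infinity. *)
Lemma point_ideal_inj P Q : on_curve E P -> on_curve E Q ->
  ideal_equiv (pm P setT) (pm Q setT) -> P = Q.
Proof.
move=> onP onQ PQ; apply: ec_sub_eq0.
have : ideal_equiv (pm (ec_add E P (ec_neg Q)) setT) setT.
  apply: ideal_equiv_trans
    (ideal_equiv_sym (point_mul_ec_add onP (ec_neg_on_curve onQ) setT_ideal)) _.
  rewrite point_mulC //.
  apply: ideal_equiv_trans (ideal_equiv_point_mul _ _ _ _ PQ) _; rewrite point_mulC //.
  apply: ideal_equiv_trans (point_mul_ec_add onQ (ec_neg_on_curve onQ) setT_ideal) _.
  by rewrite ec_add_neg; exact: ideal_equiv_refl.
have := ec_add_on_curve onP (ec_neg_on_curve onQ).
case: (ec_add E P (ec_neg Q)) => [[x y]|] // /eqP on.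
case/point_ideal_not_principal => //.
by rewrite /g hornerZ.
Qed.

Lemma ec_addC P Q : on_curve E P -> on_curve E Q -> ec_add E P Q = ec_add E Q P.
Proof.
move=> onP onQ; apply: point_ideal_inj; rewrite ?ec_add_on_curve //.
apply: ideal_equiv_trans (ideal_equiv_sym (point_mul_ec_add onP onQ setT_ideal)) _.
by rewrite point_mulC //; exact: point_mul_ec_add.
Qed.

Lemma ec_addA P Q R : on_curve E P -> on_curve E Q -> on_curve E R ->
  ec_add E P (ec_add E Q R) = ec_add E (ec_add E P Q) R.
Proof.
move=> onP onQ onR; apply: point_ideal_inj; rewrite ?ec_add_on_curve //.
apply: ideal_equiv_trans
  (ideal_equiv_sym (point_mul_ec_add onP (ec_add_on_curve onQ onR) setT_ideal)) _.
apply: ideal_equiv_trans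
  (ideal_equiv_point_mul _ _ _ P
    (ideal_equiv_sym (point_mul_ec_add onQ onR setT_ideal))) _.
apply: ideal_equiv_trans
  (point_mul_ec_add (ec_add_on_curve onP onQ) onR setT_ideal).
by apply: point_mul_ec_add => //; exact: point_mul_ideal.
Qed.

Lemma ec_add0 P : ec_add E P None = P.
Proof. by case: P => [[]|]. Qed.

Lemma ec_mulS n P : ec_mul E n.+1 P = ec_add E P (ec_mul E n P).
Proof. by []. Qed.

Lemma ec_mul2 P : ec_mul E 2 P = ec_add E P P.
Proof. by rewrite !ec_mulS ec_add0. Qed.

Lemma ec_mul_on_curve n P : on_curve E P -> on_curve E (ec_mul E n P).
Proof. by move=> onP; elim: n => // n IHn; rewrite ec_mulS ec_add_on_curve. Qed.

Lemma ec_mulD m n P : on_curve E P ->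
  ec_mul E (m + n) P = ec_add E (ec_mul E m P) (ec_mul E n P).
Proof.
move=> onP; elim: m => // m IHm.
by rewrite addSn !ec_mulS IHm ec_addA // ec_mul_on_curve.
Qed.

Lemma ec_mul_addr n P Q : on_curve E P -> on_curve E Q ->
  ec_mul E n (ec_add E P Q) = ec_add E (ec_mul E n P) (ec_mul E n Q).
Proof.
move=> onP onQ; elim: n => // n IHn.
have onnP := ec_mul_on_curve n onP; have onnQ := ec_mul_on_curve n onQ.
rewrite !ec_mulS IHn -ec_addA ?ec_add_on_curve //.
rewrite (ec_addA onQ) // (ec_addC onQ onnP).
by rewrite -(ec_addA onnP) // (ec_addA onP) ?ec_add_on_curve.
Qed.

Lemma ec_mulM m n P : on_curve E P ->
  ec_mul E (m * n) P = ec_mul E m (ec_mul E n P).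
Proof.
by move=> onP; elim: m => // m IHm; rewrite mulSn ec_mulD // ec_mulS IHm.
Qed.

Lemma ec_mul_None n : ec_mul E n None = None.
Proof. by elim: n => // n IHn; rewrite ec_mulS IHn. Qed.

Definition ec_tors P := on_curve E P /\ exists n, ec_mul E (2 ^ n) P = None.

Lemma ec_tors_add P Q : ec_tors P -> ec_tors Q -> ec_tors (ec_add E P Q).
Proof.
move=> [onP [m mP]] [onQ [n nQ]]; split; first exact: ec_add_on_curve.
exists (m + n)%N; rewrite ec_mul_addr // {1}expnD expnD.
rewrite [X in ec_mul E X P]mulnC !ec_mulM // mP nQ !ec_mul_None //.
Qed.

Lemma ec_tors_neg P : ec_tors P -> ec_tors (ec_neg P).
Proof.
move=> [onP [n nP]]; have onN := ec_neg_on_curve onP; split => //; exists n.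
by have := ec_mul_addr (2 ^ n) onP onN; rewrite nP ec_add_neg ec_mul_None.
Qed.

Lemma ec_tors_half P : on_curve E P -> ec_tors (ec_add E P P) -> ec_tors P.
Proof.
move=> onP [_ [n]]; rewrite -ec_mul2 -ec_mulM // -expnSr => nP.
by split => //; exists n.+1.
Qed.

(** Induction on n with 2^n P = 0. The step goes from P + P to P, the direction in which matches are
    lifted. *)
Lemma ec_tors_ind (T : ec_point F -> Prop) : T None ->
  (forall P, ec_tors P -> T (ec_add E P P) -> T P) -> forall P, ec_tors P -> T P.
Proof.
move=> T0 TS P [onP [n]]; elim: n P onP => [|n IHn] P onP.
  by rewrite expn0 ec_mulS ec_add0 => ->.
move=> nP; apply: TS; first by split => //; exists n.+1.
by apply: IHn; rewrite ?ec_add_on_curve // -ec_mul2 -ec_mulM // -expnSr.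
Qed.
End GroupLaw.

(** * Valuations and the uniqueness of their extension *)

Lemma rat_lt_nat (r : rat) : exists n : nat, r < n%:R.
Proof.
exists (Num.bound `|r|).
exact: le_lt_trans (ler_norm _) (archi_boundP (normr_ge0 _)).
Qed.

Section Valuation.
Variables (F : fieldType) (v : valuation F).

Definition val_ge (r : rat) (x : F) := (r%:E <= v x)%E.

(* Junk value 0 at x = 0. *)
Definition val_rat (x : F) : rat := fine (v x).

Lemma val_fin x : x != 0 -> v x = (val_rat x)%:E.
Proof.
rewrite /val_rat => x0; case vx: (v x) => [r||] //.
- by move/val_pinfty/eqP: vx; rewrite (negbTE x0).
- by case: (val_neq_ninfty vx).
Qed.

Lemma val_ge_fin r x : x != 0 -> val_ge r x = (r <= val_rat x).
Proof. by move=> x0; rewrite /val_ge val_fin. Qed.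

Lemma val_ge0 r : val_ge r 0.
Proof. by rewrite /val_ge (_ : v 0 = +oo%E) ?leey //; apply/val_pinfty. Qed.

Lemma val_ge_le r s x : s <= r -> val_ge r x -> val_ge s x.
Proof. by move=> sr; apply: le_trans; rewrite lee_fin. Qed.

Lemma val_ratM x y : x != 0 -> y != 0 -> val_rat (x * y) = val_rat x + val_rat y.
Proof.
by move=> x0 y0; rewrite {1}/val_rat val_mul (val_fin x0) (val_fin y0).
Qed.

Lemma val_rat1 : val_rat 1 = 0.
Proof. by have := val_ratM (oner_neq0 F) (oner_neq0 F); rewrite mulr1; lra. Qed.

Lemma val_ratV x : x != 0 -> val_rat x^-1 = - val_rat x.
Proof.
move=> x0; have := val_ratM x0 (invr_neq0 x0).
by rewrite mulfV // val_rat1; lra.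
Qed.

Lemma val_ratN x : val_rat (- x) = val_rat x.
Proof.
have N1 : val_rat (-1) = 0.
  have := @val_ratM (-1) (-1); rewrite oppr_eq0 oner_eq0 => /(_ isT isT).
  by rewrite mulrNN mulr1 val_rat1; lra.
have [->|x0] := eqVneq x 0; first by rewrite oppr0.
by rewrite -mulN1r val_ratM ?oppr_eq0 ?oner_eq0 // N1 add0r.
Qed.

Lemma val_geD r x y : val_ge r x -> val_ge r y -> val_ge r (x + y).
Proof.
move=> rx ry; apply: le_trans (val_add v x y).
by rewrite le_min; apply/andP.
Qed.

Lemma val_geN r x : val_ge r (- x) = val_ge r x.
Proof.
have [->|x0] := eqVneq x 0; first by rewrite oppr0.
by rewrite !val_ge_fin ?oppr_eq0 // val_ratN.
Qed.

Lemma val_geM r s x y : val_ge r x -> val_ge s y -> val_ge (r + s) (x * y).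
Proof.
have [->|x0] := eqVneq x 0; first by rewrite mul0r => *; exact: val_ge0.
have [->|y0] := eqVneq y 0; first by rewrite mulr0 => *; exact: val_ge0.
by rewrite !val_ge_fin ?mulf_neq0 // val_ratM // => *; exact: lerD.
Qed.

Lemma val_ge_sum r (I : Type) (s : seq I) (P : pred I) (G : I -> F) :
  (forall i, P i -> val_ge r (G i)) -> val_ge r (\sum_(i <- s | P i) G i).
Proof.
by move=> ge; elim/big_ind: _ => //; [exact: val_ge0|exact: val_geD].
Qed.

Lemma val_ge_exists x : exists r, val_ge r x.
Proof.
have [->|x0] := eqVneq x 0; first by exists 0; exact: val_ge0.
by exists (val_rat x); rewrite val_ge_fin.
Qed.

Lemma val_ge_exists_bound n (G : nat -> F) :
  exists r, forall j, (j < n)%N -> val_ge r (G j).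
Proof.
elim: n => [|n [r ge]]; first by exists 0.
have [s ges] := val_ge_exists (G n).
exists (Num.min r s) => j; rewrite ltnS leq_eqVlt => /predU1P[->|jn].
  by apply: val_ge_le ges; rewrite ge_min lexx orbT.
by apply: val_ge_le (ge _ jn); rewrite ge_min lexx.
Qed.

Lemma val_ge_nat_eq0 x : (forall N : nat, val_ge N%:R x) -> x = 0.
Proof.
move=> ge; apply/eqP; apply: contraT => x0.
have [n nP] := rat_lt_nat (val_rat x).
by have := ge n; rewrite val_ge_fin // leNgt nP.
Qed.

Lemma val_rat_exp n x : x != 0 -> val_rat (x ^+ n) = n%:R * val_rat x.
Proof.
move=> x0; elim: n => [|n IHn]; first by rewrite expr0 val_rat1 mul0r.
by rewrite exprS val_ratM ?expf_neq0 // IHn -natr1; ring.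
Qed.

End Valuation.

(** * Equivalence of norms over a complete field *)

Section UniqueExtension.
Variables (K L : fieldType) (iota : {rmorphism K -> L}).
Variables (v : valuation K).
Hypothesis v_complete : val_complete v.
Local Notation ev q x := (map_poly iota q).[x].

Lemma extends_val_ge (w : valuation L) r a : (forall x, w (iota x) = v x) ->
  val_ge w r (iota a) = val_ge v r a.
Proof. by move=> ext; rewrite /val_ge ext. Qed.

Lemma horner_map_wide d (q : {poly K}) (x : L) : (size q <= d)%N ->
  ev q x = \sum_(j < d) iota q`_j * x ^+ j.
Proof.
move=> qd; rewrite (@horner_coef_wide _ d) ?size_map_poly //.
by apply: eq_bigr => j _; rewrite coef_map.
Qed.

(* On the K-span of 1, x, .., x^(d-1) every coordinate is bounded by the
   valuation: by induction this span is complete, hence closed, so x^d stays at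
   a positive distance from it. *)
Lemma coef_bound (w : valuation L) (x : L) d : (forall a, w (iota a) = v a) ->
  (forall q : {poly K}, (size q <= d)%N -> ev q x = 0 -> q = 0) ->
  exists C, forall q : {poly K}, (size q <= d)%N -> forall r, val_ge w r (ev q x) ->
    forall j, val_ge v (r - C) q`_j.
Proof.
move=> ext; elim: d => [|d IHd] indep.
  exists 0 => q; rewrite leqn0 size_poly_eq0 => /eqP -> r _ j.
  by rewrite coef0; exact: val_ge0.
have [|C bound] := IHd; first by move=> q /leqW; exact: indep.
have [D farD] : exists D, forall b : {poly K}, (size b <= d)%N ->
    ~ val_ge w D (x ^+ d + ev b x).
  (* Otherwise elements of the span approach - x^d. The bound for d makes their coefficients Cauchy,
     and the limits form a monic relation of degree d for x. *)
  apply: contrapT => /forallNP close.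
  have /choice[b bP] (N : nat) : exists b : {poly K},
      (size b <= d)%N /\ val_ge w N%:R (x ^+ d + ev b x).
    by have /existsNP[b /not_implyP[sb /contrapT]] := close N%:R; exists b.
  have cauchy j : val_cauchy v (fun n => (b n)`_j).
    move=> N; have [n0 /ltW n0P] := rat_lt_nat (N%:R + C).
    exists n0 => m n lem len; rewrite -coefB -/(val_ge v _ _).
    apply: (@val_ge_le _ _ (n0%:R - C)); first by rewrite lerBrDr.
    apply: bound.
      by rewrite (leq_trans (size_polyD _ _)) // geq_max size_polyN !(bP _).1.
    rewrite rmorphB hornerD hornerN.
    have -> : ev (b m) x - ev (b n) x =
      (x ^+ d + ev (b m) x) + - (x ^+ d + ev (b n) x) by ring.
    apply: val_geD; rewrite ?val_geN; apply: val_ge_le (bP _).2;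
      by rewrite ler_nat.
  have /choice[l lP] j := v_complete (cauchy j).
  pose q := \poly_(j < d) l j.
  have [M MP] := val_ge_exists_bound w d (fun j => x ^+ j).
  have lim0 : x ^+ d + ev q x = 0.
    apply: (@val_ge_nat_eq0 _ w) => N.
    have [N1 N1P] := rat_lt_nat (N%:R - M).
    have /choice[n0 n0P] (j : nat) := lP j N1.
    pose n := (N + \max_(j < d) n0 j)%N.
    have -> : x ^+ d + ev q x =
        (x ^+ d + ev (b n) x) + \sum_(j < d) iota (l j - (b n)`_j) * x ^+ j.
      rewrite (horner_map_wide x (bP n).1) (horner_map_wide x (size_poly _ _)).
      rewrite -addrA -big_split /=; congr (_ + _); apply: eq_bigr => j _.
      by rewrite coef_poly ltn_ord rmorphB /=; ring.
    apply: val_geD.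
      by apply: val_ge_le (bP n).2; rewrite ler_nat leq_addr.
    apply: val_ge_sum => j _; apply: (@val_ge_le _ _ (N1%:R + M)); first by lra.
    apply: val_geM; last exact: MP.
    rewrite (extends_val_ge _ _ ext) -opprB val_geN; apply: n0P.
    by rewrite /n; apply: leq_trans (leq_addl _ _); exact: leq_bigmax.
  have : 'X^d + q = 0.
    apply: indep; last by rewrite rmorphD /= map_polyXn hornerD hornerXn.
    rewrite (leq_trans (size_polyD _ _)) // geq_max size_polyXn leqnn /=.
    exact: leqW (size_poly _ _).
  move/(congr1 (fun p : {poly K} => p`_d))/eqP.
  by rewrite coefD coefXn coef_poly ltnn eqxx addr0 coef0 oner_eq0.
have [s sP] := val_ge_exists w (x ^+ d).
(* The leading coefficient loses at most D. Its term then has valuation at least r - D + s, so that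
   removing it leaves t with a loss of at most max(0, D - s), to which the constant C for degree
   below d is added. *)
exists (Num.max D (C + Num.max 0 (D - s))) => q sq r rq.
have CD : C + Num.max 0 (D - s) <= Num.max D (C + Num.max 0 (D - s)).
  by rewrite le_max lexx orbT.
have DD : D <= Num.max D (C + Num.max 0 (D - s)) by rewrite le_max lexx.
have M0 : 0 <= Num.max 0 (D - s) by rewrite le_max lexx.
have MD : D - s <= Num.max 0 (D - s) by rewrite le_max lexx orbT.
set a := q`_d; pose t := take_poly d q.
have st : (size t <= d)%N := size_take_poly d q.
have qE : q = t + a *: 'X^d.
  apply/polyP => j; rewrite coefD coefZ coefXn coef_take_poly.
  case: ltngtP => [jd|jd|->]; rewrite ?mulr0 ?mulr1 ?addr0 ?add0r //.
  by rewrite nth_default // (leq_trans sq).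
have evq : ev q x = ev t x + iota a * x ^+ d.
  by rewrite {1}qE rmorphD /= map_polyZ map_polyXn hornerD hornerZ hornerXn.
have ge_a : val_ge v (r - D) a.
  have [->|a0] := eqVneq a 0; first exact: val_ge0.
  have ia0 : iota a != 0 by rewrite fmorph_eq0.
  (* If v(a) < r - D, then q(x) / a is x^d plus an element of the span and has valuation at least
     D. *)
  rewrite val_ge_fin // leNgt; apply/negP => lt_a.
  apply: (farD (a^-1 *: t)).
    by rewrite (leq_trans (size_scale_leq _ _)).
  have -> : x ^+ d + ev (a^-1 *: t) x = iota a^-1 * ev q x.
    by rewrite map_polyZ hornerZ evq fmorphV; field.
  apply: (@val_ge_le _ _ (- val_rat v a + r)); first by lra.
  apply: val_geM => //; rewrite (extends_val_ge _ _ ext).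
  by rewrite val_ge_fin ?invr_eq0 // val_ratV.
have ge_t : val_ge w (r - Num.max 0 (D - s)) (ev t x).
  have -> : ev t x = ev q x + - (iota a * x ^+ d) by rewrite evq; ring.
  apply: val_geD; first by apply: val_ge_le rq; lra.
  rewrite val_geN; apply: (@val_ge_le _ _ (r - D + s)); first by lra.
  by apply: val_geM => //; rewrite extends_val_ge.
move=> j; have := bound t st _ ge_t j; rewrite coef_take_poly.
case: ltngtP => [jd|jd|->] gej.
- by apply: val_ge_le gej; lra.
- by rewrite nth_default ?(leq_trans sq) //; exact: val_ge0.
- by apply: val_ge_le ge_a; lra.
Qed.

(** Equivalence of norms loses only additive constants, which powers of x make negligible. Reducing
    X^n modulo a polynomial of least degree killing x gives coefficients of valuation at least n
    w(x) - C, whence w'(x^n) is at least n w(x) - C + M for all n. *)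
Lemma val_ext_le (w w' : valuation L) (x : L) : (forall a, w (iota a) = v a) ->
  (forall a, w' (iota a) = v a) -> algebraicOver iota x -> x != 0 ->
  val_rat w x <= val_rat w' x.
Proof.
move=> ext ext' [p0 p0_neq0 root_p0] x0.
have [p [p_neq0 root_p min_p]] : exists p : {poly K},
    [/\ p != 0, root (map_poly iota p) x &
      forall q : {poly K}, (size q < size p)%N -> ev q x = 0 -> q = 0].
  have [n] := ubnP (size p0); elim: n p0 p0_neq0 root_p0 => // n IHn p p0 rp sp.
  have [min|] := pselect (forall q : {poly K},
      (size q < size p)%N -> ev q x = 0 -> q = 0).
    by exists p.
  move=> /existsNP[q /not_implyP[sq /not_implyP[/eqP rq /eqP q0]]].
  by apply: IHn q0 rq _; rewrite (leq_trans sq).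
pose d := (size p).-1.
have p_gt0 : (0 < size p)%N by rewrite size_poly_gt0.
have [C bound] : exists C, forall q : {poly K}, (size q <= d)%N -> forall r,
    val_ge w r (ev q x) -> forall j, val_ge v (r - C) q`_j.
  apply: coef_bound => // q sq; apply: min_p.
  by rewrite (leq_ltn_trans sq) // prednK.
have [M MP] := val_ge_exists_bound w' d (fun j => x ^+ j).
have step n : n%:R * val_rat w x - C + M <= n%:R * val_rat w' x.
  pose q := 'X^n %% p.
  have sq : (size q <= d)%N by rewrite -ltnS prednK // ltn_modp.
  have evq : ev q x = x ^+ n.
    have /(congr1 (fun q => ev q x)) := divp_eq 'X^n p.
    rewrite rmorphD rmorphM /= map_polyXn hornerD hornerM hornerXn.
    by rewrite (rootP root_p) mulr0 add0r => <-.
  have := bound q sq (n%:R * val_rat w x).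
  rewrite evq val_ge_fin ?expf_neq0 // val_rat_exp // lexx => /(_ isT) ge_q.
  rewrite -[leRHS](val_rat_exp _ n x0) -val_ge_fin ?expf_neq0 //.
  rewrite -evq (horner_map_wide x sq); apply: val_ge_sum => j _.
  by apply: val_geM; [rewrite extends_val_ge|exact: MP].
rewrite leNgt; apply/negP => lt.
have [n nP] := rat_lt_nat ((C - M) / (val_rat w x - val_rat w' x)).
rewrite ltr_pdivrMr ?subr_gt0 // in nP.
by have := step n; lra.
Qed.

End UniqueExtension.

(** * Congruence modulo 1 + m *)

Section Close.
Variables (F : fieldType) (v : valuation F).
Local Notation vr := (val_rat v).

(* With this formulation 0 is close to 0 only, and inverses need no side condition. *)
Definition close (a b : F) := exists t, maximal_ideal v (t - 1) /\ b = a * t.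

Lemma maximal_idealP x : maximal_ideal v x <-> exists2 r, 0 < r & val_ge v r x.
Proof.
rewrite /maximal_ideal /=; have [->|x0] := eqVneq x 0.
  split=> _; first by exists 1 => //; exact: val_ge0.
  by rewrite (_ : v 0 = +oo%E) ?ltry //; apply/val_pinfty.
rewrite val_fin // lte_fin; split=> [x_gt0|[r r0]].
  by exists (vr x); rewrite ?val_ge_fin.
by rewrite val_ge_fin //; exact: lt_le_trans.
Qed.

Lemma maximal_ideal_fin x : x != 0 -> maximal_ideal v x <-> 0 < vr x.
Proof. by move=> x0; rewrite /maximal_ideal /= val_fin // lte_fin. Qed.

Lemma maximal_idealD x y :
  maximal_ideal v x -> maximal_ideal v y -> maximal_ideal v (x + y).
Proof.
move=> /maximal_idealP[r r0 rx] /maximal_idealP[s s0 sy]; apply/maximal_idealP.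
exists (Num.min r s); first by rewrite lt_min r0.
by apply: val_geD; [apply: val_ge_le rx|apply: val_ge_le sy];
  rewrite ge_min lexx ?orbT.
Qed.

Lemma maximal_idealM r x :
  val_ge v 0 r -> maximal_ideal v x -> maximal_ideal v (r * x).
Proof.
move=> r0 /maximal_idealP[s s0 sx]; apply/maximal_idealP; exists (0 + s).
  by rewrite add0r.
exact: val_geM.
Qed.

Lemma maximal_idealN x : maximal_ideal v x -> maximal_ideal v (- x).
Proof.
by move=> /maximal_idealP[s s0 sx]; apply/maximal_idealP; exists s; rewrite ?val_geN.
Qed.

Lemma maximal_ideal1 : ~ maximal_ideal v 1.
Proof. by move/(maximal_ideal_fin (oner_neq0 F)); rewrite val_rat1 ltxx. Qed.

Lemma one_unit_neq0 t : maximal_ideal v (t - 1) -> t != 0.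
Proof.
move=> mt; apply/eqP => t0; apply: maximal_ideal1.
by move/maximal_idealN: mt; rewrite t0 sub0r opprK.
Qed.

Lemma one_unit_val t : maximal_ideal v (t - 1) -> vr t = 0.
Proof.
move=> mt; have t0 := one_unit_neq0 mt; apply/eqP; rewrite eq_le.
apply/andP; split.
  rewrite leNgt; apply/negP => vt; apply: maximal_ideal1.
  rewrite (_ : 1 = t - (t - 1)); last by ring.
  by apply: maximal_idealD; [apply/maximal_ideal_fin|exact: maximal_idealN].
rewrite -val_ge_fin // (_ : t = (t - 1) + 1); last by ring.
apply: val_geD; last by rewrite val_ge_fin ?oner_neq0 // val_rat1.
have /maximal_idealP[r r0] := mt; apply: val_ge_le; exact: ltW.
Qed.

Lemma one_unit_ge0 t : maximal_ideal v (t - 1) -> val_ge v 0 t.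
Proof. by move=> mt; rewrite val_ge_fin ?one_unit_neq0 // one_unit_val. Qed.

Lemma close_refl a : close a a.
Proof.
exists 1; rewrite subrr mulr1; split => //.
by apply/maximal_idealP; exists 1; rewrite ?val_ge0.
Qed.

Lemma close_sym a b : close a b -> close b a.
Proof.
move=> [t [mt ->]]; have t0 := one_unit_neq0 mt; exists t^-1.
split; last by field.
rewrite (_ : t^-1 - 1 = - t^-1 * (t - 1)); last by field.
apply: maximal_idealM => //.
by rewrite val_geN val_ge_fin ?invr_eq0 // val_ratV // one_unit_val // oppr0.
Qed.

Lemma closeM a a' b b' : close a a' -> close b b' -> close (a * b) (a' * b').
Proof.
move=> [t [mt ->]] [s [ms ->]]; exists (t * s); split; last by ring.
rewrite (_ : t * s - 1 = t * (s - 1) + (t - 1)); last by ring.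
by apply: maximal_idealD => //; apply: maximal_idealM => //; exact: one_unit_ge0.
Qed.

Lemma close_trans a b c : close a b -> close b c -> close a c.
Proof.
move=> [t [mt ->]] [s [ms ->]]; exists (t * s); split; last by ring.
rewrite (_ : t * s - 1 = t * (s - 1) + (t - 1)); last by ring.
by apply: maximal_idealD => //; apply: maximal_idealM => //; exact: one_unit_ge0.
Qed.

Lemma closeV a b : close a b -> close a^-1 b^-1.
Proof.
move=> ab; have [t [mt ->]] := close_sym ab; exists t; split => //.
have t0 := one_unit_neq0 mt.
have [->|b0] := eqVneq b 0; first by rewrite mul0r invr0 mul0r.
by field; rewrite b0 t0.
Qed.

Lemma close_div a a' b b' : close a a' -> close b b' -> close (a / b) (a' / b').
Proof. by move=> aa' bb'; apply: closeM => //; exact: closeV. Qed.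

Lemma closeX a a' n : close a a' -> close (a ^+ n) (a' ^+ n).
Proof.
move=> aa'; elim: n => [|n IHn]; first by rewrite !expr0; exact: close_refl.
by rewrite !exprS; exact: closeM.
Qed.

Lemma closeN a a' : close a a' -> close (- a) (- a').
Proof. by move=> [t [mt ->]]; exists t; rewrite mulNr. Qed.

Lemma close_eq0 a b : close a b -> (a == 0) = (b == 0).
Proof.
by move=> [t [mt ->]]; rewrite mulf_eq0 (negbTE (one_unit_neq0 mt)) orbF.
Qed.

Lemma close0 b : close 0 b -> b = 0.
Proof. by move=> [t [_ ->]]; rewrite mul0r. Qed.

Lemma close_val a b : close a b -> vr a = vr b.
Proof.
move=> [t [mt ->]]; have [->|a0] := eqVneq a 0; first by rewrite mul0r.
by rewrite val_ratM ?(one_unit_neq0 mt) // (one_unit_val mt) addr0.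
Qed.

Lemma close_sub a b : a != 0 -> close a b <-> exists2 r, vr a < r & val_ge v r (b - a).
Proof.
move=> a0; split.
  move=> [t [/maximal_idealP[r r0 rt] ->]]; exists (vr a + r); first by lra.
  rewrite (_ : a * t - a = a * (t - 1)); last by ring.
  by apply: val_geM => //; rewrite val_ge_fin ?lexx.
move=> [r ra rab]; exists (b / a); split; last by field.
apply/maximal_idealP; exists (- vr a + r); first lra.
rewrite (_ : b / a - 1 = a^-1 * (b - a)); last by field.
by apply: val_geM => //; rewrite val_ge_fin ?invr_eq0 // val_ratV.
Qed.

(** The two lower bounds exclude cancellation in a - b, so the relative errors of a and b remain
    small relative to a - b. *)
Lemma closeB a a' b b' : close a a' -> close b b' -> a - b != 0 ->
  val_ge v (vr (a - b)) a -> val_ge v (vr (a - b)) b -> close (a - b) (a' - b').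
Proof.
move=> [t [/maximal_idealP[r r0 rt] ->]] [s [/maximal_idealP[q q0 qs] ->]] ab0 ga gb.
apply/close_sub => //; exists (vr (a - b) + Num.min r q).
  by rewrite ltrDl lt_min r0.
rewrite (_ : _ - (a - b) = a * (t - 1) - b * (s - 1)); last by ring.
apply: val_geD; rewrite ?val_geN; apply: val_geM => //.
  by apply: val_ge_le rt; rewrite ge_min lexx.
by apply: val_ge_le qs; rewrite ge_min lexx orbT.
Qed.

Hypothesis two_neq0 : 2%:R != 0 :> F.
Hypothesis val2 : vr 2%:R = 0.

Lemma val_ge_double r x : val_ge v r (2%:R * x) -> val_ge v r x.
Proof.
move=> ge; rewrite (_ : x = 2%:R^-1 * (2%:R * x)); last by field.
rewrite -[r]add0r; apply: val_geM => //.
by rewrite val_ge_fin ?invr_eq0 // val_ratV // val2 oppr0.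
Qed.

(* As 2 is a unit, at most one of a - b and a + b involves cancellation; the
   other one is controlled directly and then the remaining one by a^2 - b^2. *)
Lemma close_sqrB a a' b b' : close a a' -> close b b' ->
  close (a ^+ 2 - b ^+ 2) (a' ^+ 2 - b' ^+ 2) -> close (a - b) (a' - b').
Proof.
move=> aa' bb' sq.
have [a0|a0] := eqVneq a 0.
  by move: aa'; rewrite a0 => /close0 ->; rewrite !sub0r; exact: closeN.
have [b0|b0] := eqVneq b 0.
  by move: bb'; rewrite b0 => /close0 ->; rewrite !subr0.
have vaa := val_ge_fin v _ a0; have vbb := val_ge_fin v _ b0.
(* r witnesses cancellation in a - b. A bound r instead of the valuation itself also covers a = b,
   where [val_rat] takes its junk value. *)
have [[r [ra rb rab]]|no_r] :=
    pselect (exists r, [/\ vr a < r \/ vr b < r, True & val_ge v r (a - b)]); last first.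
  have ab0 : a - b != 0.
    apply/eqP => ab0; apply: no_r; exists (vr a + 1); split => //; first by left; lra.
    by rewrite ab0; exact: val_ge0.
  apply: closeB => //.
    rewrite vaa leNgt; apply/negP => lt; apply: no_r; exists (vr (a - b)).
    by split; [left| |rewrite val_ge_fin].
  rewrite vbb leNgt; apply/negP => lt; apply: no_r; exists (vr (a - b)).
  by split; [right| |rewrite val_ge_fin].
(* Cancellation in both a - b and a + b would bound 2a and 2b, hence a and b, below by min(r, s),
   which exceeds v(a) or v(b). *)
have not_both s : val_ge v s (a + b) -> vr a < s \/ vr b < s -> False.
  move=> sab ls.
  have ga : val_ge v (Num.min r s) a.
    apply: val_ge_double; rewrite (_ : 2%:R * a = (a - b) + (a + b)); last by ring.
    by apply: val_geD; [apply: val_ge_le rab|apply: val_ge_le sab];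
      rewrite ge_min lexx ?orbT.
  have gb : val_ge v (Num.min r s) b.
    apply: val_ge_double; rewrite (_ : 2%:R * b = - (a - b) + (a + b)); last by ring.
    by apply: val_geD; rewrite ?val_geN; [apply: val_ge_le rab|apply: val_ge_le sab];
      rewrite ge_min lexx ?orbT.
  rewrite vaa in ga; rewrite vbb in gb.
  by move: ga gb; rewrite !ge_min => /orP[] ? /orP[] ?; case: ra; case: ls; lra.
have ab0 : a - - b != 0.
  rewrite opprK; apply/eqP => ab0; apply: (@not_both (vr a + 1)).
    by rewrite ab0; exact: val_ge0.
  by left; lra.
have sE : a + b = a - - b by rewrite opprK.
have sumE : close (a - - b) (a' - - b').
  apply: closeB => //; first exact: closeN.
    rewrite vaa leNgt; apply/negP => lt; apply: not_both; last by left; exact: lt.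
    by rewrite sE val_ge_fin.
  rewrite val_geN vbb leNgt; apply/negP => lt; apply: not_both; last by right; exact: lt.
  by rewrite sE val_ge_fin.
have ab0' : a' - - b' != 0 by rewrite -(close_eq0 sumE).
have -> : a - b = (a ^+ 2 - b ^+ 2) / (a - - b) by field.
have -> : a' - b' = (a' ^+ 2 - b' ^+ 2) / (a' - - b') by field.
exact: close_div.
Qed.

Lemma close_sqrD a a' b b' : close a a' -> close b b' ->
  close (a ^+ 2 - b ^+ 2) (a' ^+ 2 - b' ^+ 2) -> close (a + b) (a' + b').
Proof.
move=> aa' bb' sq; rewrite -[b]opprK -[b']opprK.
by apply: close_sqrB => //; rewrite ?sqrrN //; exact: closeN.
Qed.

(** The product (b/a - 1)(- b/a - 1) = 1 - (b/a)^2 has positive valuation, hence so has one of its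
    factors. *)
Lemma close_sqrt a b : close (a ^+ 2) (b ^+ 2) -> close a b \/ close a (- b).
Proof.
have [->|a0] := eqVneq a 0.
  rewrite expr0n => /close0/eqP; rewrite sqrf_eq0 => /eqP ->.
  by left; exact: close_refl.
move=> /(closeM (close_refl (a ^- 2))); rewrite mulVf ?expf_neq0 //.
move=> [t [mt tE]].
have fact : (b / a - 1) * (- b / a - 1) = - (t - 1).
  have -> : t = a ^- 2 * b ^+ 2 by rewrite tE mul1r.
  by field.
have [mp|np] := pselect (maximal_ideal v (b / a - 1)).
  by left; exists (b / a); split => //; field.
have [mq|nq] := pselect (maximal_ideal v (- b / a - 1)).
  by right; exists (- b / a); split => //; field.
have nm0 x : ~ maximal_ideal v x -> x != 0.
  move=> nx; apply/eqP => x0; apply: nx; rewrite x0.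
  by apply/maximal_idealP; exists 1; rewrite ?val_ge0.
have p0 := nm0 _ np; have q0 := nm0 _ nq.
have := maximal_idealN mt; rewrite -fact => /maximal_ideal_fin.
rewrite mulf_neq0 // val_ratM // => /(_ isT).
case: (ltP 0 (vr (b / a - 1))) => [/(maximal_ideal_fin p0)//|?].
case: (ltP 0 (vr (- b / a - 1))) => [/(maximal_ideal_fin q0)//|?].
by lra.
Qed.

(** For a nonzero, b/a and - b/a would both be 1 modulo m, which puts 2 in m. This excludes the
    wrong sign of a square root. *)
Lemma close_opp a b : close a b -> close a (- b) -> a = 0.
Proof.
move=> [t [mt ->]] [s [ms tsE]]; apply/eqP; apply: contraT => a0.
have ts : t = - s.
  by apply: (mulfI a0); rewrite mulrN -tsE opprK.
have : maximal_ideal v (- (t - 1) + - (s - 1)).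
  by apply: maximal_idealD; exact: maximal_idealN.
rewrite ts (_ : _ + _ = 2%:R); last by ring.
by move/(maximal_ideal_fin two_neq0); rewrite val2 ltxx.
Qed.

Lemma closeD2 t a b : close t a -> close t b -> close (2%:R * t) (a + b).
Proof.
move=> [r [mr ->]] [s [ms ->]]; exists ((r + s) / 2%:R); split; last by field.
rewrite (_ : _ - 1 = 2%:R^-1 * ((r - 1) + (s - 1))); last by field.
apply: maximal_idealM; last exact: maximal_idealD.
by rewrite val_ge_fin ?invr_eq0 // val_ratV // val2 oppr0.
Qed.
End Close.

(** * Addition and halving in terms of the roots *)

Section Formulas.
Variables (F : fieldType) (E : cubic_eqn F).
Local Notation c := (ccst E).
Local Notation f := (cpol E).
Hypothesis smooth : smooth_cubic E.

Let two_neq0 : 2%:R != 0 :> F. Proof. by case: smooth. Qed.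
Let c_neq0 : c != 0. Proof. by case: smooth. Qed.

Definition splits_at (f : {poly F}) r1 r2 r3 :=
  [/\ f = ('X - r1%:P) * ('X - r2%:P) * ('X - r3%:P), r1 != r2, r1 != r3 & r2 != r3].

Lemma splits_horner r1 r2 r3 x : splits_at f r1 r2 r3 ->
  f.[x] = (x - r1) * (x - r2) * (x - r3).
Proof. by case=> -> _ _ _; rewrite !hornerE. Qed.

Lemma splits_deriv r1 r2 r3 x : splits_at f r1 r2 r3 ->
  f^`().[x] = (x - r1) * (x - r2) + (x - r1) * (x - r3) + (x - r2) * (x - r3).
Proof.
case=> -> _ _ _; rewrite !derivM !derivXsubC.
by rewrite !(hornerD, hornerM, hornerN, hornerX, hornerC); ring.
Qed.

Lemma eq_opp (y : F) : (y == - y) = (y == 0).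
Proof.
rewrite -subr_eq0 opprK (_ : y + y = 2%:R * y); last by ring.
by rewrite mulf_eq0 (negbTE two_neq0).
Qed.

Lemma splits_coef2 r1 r2 r3 : splits_at f r1 r2 r3 -> f`_2 = - (r1 + r2 + r3).
Proof.
case=> -> _ _ _; rewrite -mulrA mulrBl coefB coefXM /= coefCM.
rewrite mulrBl !coefB !coefXM /= !coefCM !coefB !coefX !coefC /=; ring.
Qed.

Lemma splits_root r1 r2 r3 r : splits_at f r1 r2 r3 ->
  root f r = [|| r == r1, r == r2 | r == r3].
Proof. by case=> -> _ _ _; rewrite !rootM !root_XsubC orbA. Qed.

Lemma splits_on_curve r1 r2 r3 x y : splits_at f r1 r2 r3 ->
  on_curve E (Some (x, y)) -> y ^+ 2 = c * ((x - r1) * (x - r2) * (x - r3)).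
Proof. by move=> fE /eqP ->; rewrite (splits_horner _ fE). Qed.

Lemma root_on_curve r : root f r -> on_curve E (Some (r, 0)).
Proof. by move/rootP => /= ->; rewrite mulr0 expr0n. Qed.

Lemma on_curve_x_opp x y y' : on_curve E (Some (x, y)) -> on_curve E (Some (x, y')) ->
  y = y' \/ y = - y'.
Proof.
move=> /eqP on /eqP on'; have /eqP : y ^+ 2 = y' ^+ 2 by rewrite on on'.
by rewrite eqf_sqr => /orP[] /eqP; [left|right].
Qed.

(** The line L through the two points has ordinate (y1 (x2 - r) - y2 (x1 - r)) / (x2 - x1) above r.
    Evaluating c f - L^2 at a root gives the first claim. Evaluating it at the zero of L gives the
    product of L over the roots, hence the second, which determines the sign of y3. *)
Lemma ec_add_root x1 y1 x2 y2 x3 y3 : on_curve E (Some (x1, y1)) ->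
  on_curve E (Some (x2, y2)) -> x1 != x2 ->
  ec_add E (Some (x1, y1)) (Some (x2, y2)) = Some (x3, y3) ->
  (forall r, root f r -> c * (x1 - r) * (x2 - r) * (x3 - r) * (x2 - x1) ^+ 2 =
     (y1 * (x2 - r) - y2 * (x1 - r)) ^+ 2) /\
  forall r1 r2 r3, splits_at f r1 r2 r3 ->
    - (y1 * y2 * y3) * (x2 - x1) ^+ 3 =
    (y1 * (x2 - r1) - y2 * (x1 - r1)) * (y1 * (x2 - r2) - y2 * (x1 - r2)) *
    (y1 * (x2 - r3) - y2 * (x1 - r3)).
Proof.
move=> on1 on2 x12; case: (ec_addP smooth on1 on2) => // l z e2 e1 e0 yl _ [<- <-].
have lineE r : y1 * (x2 - r) - y2 * (x1 - r) = (y1 + l * (r - x1)) * (x2 - x1).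
  by rewrite yl; ring.
have norm x : c * f.[x] - (y1 + l * (x - x1)) ^+ 2 = c * (x - x1) * (x - x2) * (x - z).
  by rewrite (horner_cubic smooth) !mulrDr !mulrA e2 e1 e0; ring.
split=> [r /rootP fr|r1 r2 r3 fE].
  rewrite lineE; have := norm r; rewrite fr mulr0 => normr.
  by rewrite exprMn -[(y1 + _) ^+ 2]opprK -[- _ ^+ 2]add0r normr; ring.
rewrite !lineE.
have prodE : (y1 + l * (r1 - x1)) * (y1 + l * (r2 - x1)) * (y1 + l * (r3 - x1)) =
    y1 * y2 * (y1 + l * (z - x1)).
  have normE x : c * ((x - r1) * (x - r2) * (x - r3)) - (y1 + l * (x - x1)) ^+ 2 =
      c * (x - x1) * (x - x2) * (x - z) by rewrite -(splits_horner _ fE).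
  have [l0|l0] := eqVneq l 0; first by rewrite yl l0; ring.
  have := normE (x1 - y1 / l).
  have -> : y1 + l * (x1 - y1 / l - x1) = 0 by field.
  rewrite expr0n subr0 -!mulrA => /(mulfI c_neq0) E1.
  have : (- l) ^+ 3 * ((x1 - y1 / l - r1) * ((x1 - y1 / l - r2) * (x1 - y1 / l - r3))) =
         (- l) ^+ 3 * ((x1 - y1 / l - x1) * ((x1 - y1 / l - x2) * (x1 - y1 / l - z))).
    by rewrite E1.
  rewrite yl => E2.
  transitivity ((- l) ^+ 3 *
    ((x1 - y1 / l - r1) * ((x1 - y1 / l - r2) * (x1 - y1 / l - r3)))); first by field.
  by rewrite E2; field.
transitivity ((y1 + l * (r1 - x1)) * (y1 + l * (r2 - x1)) * (y1 + l * (r3 - x1)) *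
  (x2 - x1) ^+ 3); last by ring.
by rewrite prodE; ring.
Qed.

(** Translation by (r1, 0) is a Moebius involution on abscissas. All x3 - r_i become products and
    quotients of differences already controlled, so no cancellation can arise. *)
Lemma ec_add_two_torsion r1 r2 r3 x y : splits_at f r1 r2 r3 ->
  on_curve E (Some (x, y)) -> x != r1 ->
  exists x3 y3, [/\ ec_add E (Some (x, y)) (Some (r1, 0)) = Some (x3, y3),
    x3 - r1 = (r1 - r2) * (r1 - r3) / (x - r1),
    x3 - r2 = (r1 - r2) * (x - r3) / (x - r1),
    x3 - r3 = (r1 - r3) * (x - r2) / (x - r1) &
    y3 = - y * ((r1 - r2) * (r1 - r3)) / (x - r1) ^+ 2].
Proof.
move=> fE /(splits_on_curve fE) yE xr.
have xr' : r1 - x != 0 by rewrite subr_eq0 eq_sym.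
have xr'' : x - r1 != 0 by rewrite subr_eq0.
rewrite /= (negbTE xr) /ec_third (splits_coef2 fE) sub0r.
set l := - y / _; set x3 := _ - x - r1.
have l2 : l ^+ 2 / c = (x - r2) * (x - r3) / (x - r1).
  by rewrite /l expr_div_n sqrrN yE; field; rewrite c_neq0 xr' xr''.
have x3E : x3 = (x - r2) * (x - r3) / (x - r1) + r2 + r3 - x.
  by rewrite /x3 l2; ring.
exists x3, (- (y + l * (x3 - x))); split=> //.
- by rewrite x3E; field.
- by rewrite x3E; field.
- by rewrite x3E; field.
- by rewrite x3E /l; field; rewrite xr' xr''.
Qed.

(** * Halving through square roots of the x - r_i *)

Section Doubling.
Variables (r1 r2 r3 s : F).
Hypothesis fE : splits_at f r1 r2 r3.
Hypothesis sE : c = s ^+ 2.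

Let s_neq0 : s != 0.
Proof. by apply: contraNneq c_neq0 => s0; rewrite sE s0 expr0n. Qed.

(* x - r_i is a square for each i exactly when (x, y) can be halved; a choice of
   square roots a_i with y = s a1 a2 a3 determines the half. *)
Lemma ec_half a1 a2 a3 x X Y :
  a1 ^+ 2 = x - r1 -> a2 ^+ 2 = x - r2 -> a3 ^+ 2 = x - r3 ->
  a1 + a2 != 0 -> a1 + a3 != 0 -> a2 + a3 != 0 ->
  X = r1 + (a1 + a2) * (a1 + a3) -> Y = s * ((a1 + a2) * (a1 + a3) * (a2 + a3)) ->
  on_curve E (Some (X, Y)) /\
  ec_add E (Some (X, Y)) (Some (X, Y)) = Some (x, s * (a1 * a2 * a3)).
Proof.
move=> a1E a2E a3E a12 a13 a23 XE YE.
have r1E : r1 = x - a1 ^+ 2 by rewrite a1E; ring.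
have r2E : r2 = x - a2 ^+ 2 by rewrite a2E; ring.
have r3E : r3 = x - a3 ^+ 2 by rewrite a3E; ring.
split.
  by rewrite /= (splits_horner _ fE) XE YE sE r1E r2E r3E; apply/eqP; ring.
have Y0 : Y != 0 by rewrite YE !mulf_neq0.
rewrite /= eqxx eq_opp (negbTE Y0).
have -> : c * f^`().[X] / (2%:R * Y) = s * (a1 + a2 + a3).
  rewrite (splits_deriv _ fE) XE YE sE r1E r2E r3E; field.
  by rewrite two_neq0 a12 a13 a23 s_neq0.
rewrite /ec_third (splits_coef2 fE) XE YE sE r1E r2E r3E.
by congr (Some (_, _)); field.
Qed.

Lemma ec_half_roots x y X Y : on_curve E (Some (X, Y)) ->
  ec_add E (Some (X, Y)) (Some (X, Y)) = Some (x, y) ->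
  exists a1 a2 a3,
    [/\ [/\ a1 ^+ 2 = x - r1, a2 ^+ 2 = x - r2 & a3 ^+ 2 = x - r3],
        y = s * (a1 * a2 * a3),
        [/\ X - r1 = (a1 + a2) * (a1 + a3), X - r2 = (a1 + a2) * (a2 + a3)
          & X - r3 = (a1 + a3) * (a2 + a3)] &
        Y = s * ((a1 + a2) * (a1 + a3) * (a2 + a3)) /\ Y != 0].
Proof.
move=> /(splits_on_curve fE) YE; rewrite /= eqxx.
rewrite eq_opp.
have [//|Y0] := eqVneq Y 0.
have : Y ^+ 2 != 0 by rewrite expf_neq0.
rewrite YE !mulf_eq0 !negb_or => /and3P[_ /andP[X1 X2] X3].
rewrite /ec_third (splits_deriv _ fE) (splits_coef2 fE).
set Z1 := X - r1 in X1 YE *; set Z2 := X - r2 in X2 YE *; set Z3 := X - r3 in X3 YE *.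
(* The tangent slope is Y / 2 times the logarithmic derivative of f at X. *)
have lE : c * (Z1 * Z2 + Z1 * Z3 + Z2 * Z3) / (2%:R * Y) =
    Y / 2%:R * (Z1^-1 + Z2^-1 + Z3^-1).
  apply: (mulIf Y0).
  rewrite [RHS](_ : _ = Y ^+ 2 / 2%:R * (Z1^-1 + Z2^-1 + Z3^-1)); last by ring.
  by rewrite YE; field; rewrite X1 X2 X3 two_neq0 Y0.
rewrite lE; set l := Y / 2%:R * _; case=> xE yE.
have sY : s ^+ 2 = Y ^+ 2 / (Z1 * Z2 * Z3).
  by rewrite -sE YE; field; rewrite X1 X2 X3.
have sV : s^-1 ^+ 2 = Z1 * Z2 * Z3 / Y ^+ 2.
  by rewrite exprVn sY; field; rewrite X1 X2 X3 Y0.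
(* Forced by the shape of a half: the slope is l = s (a1 + a2 + a3), and Y / Z1 = s (a2 + a3). *)
pose a Z := (l - Y / Z) / s.
have sumE Zi Zj Zk : Zi != 0 -> Zj != 0 -> Zk != 0 ->
  Zi^-1 + Zj^-1 + Zk^-1 = Z1^-1 + Z2^-1 + Z3^-1 -> a Zi + a Zj = Y / (s * Zk).
  move=> Zi0 Zj0 Zk0 e; rewrite /a /l -e.
  by field; rewrite two_neq0 Zi0 Zj0 Zk0 s_neq0.
have a12 : a Z1 + a Z2 = Y / (s * Z3) by apply: sumE.
have a13 : a Z1 + a Z3 = Y / (s * Z2) by apply: sumE => //; ring.
have a23 : a Z2 + a Z3 = Y / (s * Z1) by apply: sumE => //; ring.
have s0 := s_neq0.
have xE' : x = l ^+ 2 * (Z1 * Z2 * Z3) / Y ^+ 2 + (r1 + r2 + r3) - X - X.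
  by rewrite -xE sE sY; field; rewrite X1 X2 X3 Y0.
have aE Z : a Z ^+ 2 = (l - Y / Z) ^+ 2 * (Z1 * Z2 * Z3) / Y ^+ 2.
  by rewrite /a exprMn sV !mulrA.
exists (a Z1), (a Z2), (a Z3); split.
- split; rewrite aE xE'.
  + transitivity (l ^+ 2 * (Z1 * Z2 * Z3) / Y ^+ 2 - Z2 - Z3).
      by rewrite /l; field; rewrite X1 X2 X3 Y0 two_neq0.
    by rewrite /Z2 /Z3; ring.
  + transitivity (l ^+ 2 * (Z1 * Z2 * Z3) / Y ^+ 2 - Z1 - Z3).
      by rewrite /l; field; rewrite X1 X2 X3 Y0 two_neq0.
    by rewrite /Z1 /Z3; ring.
  + transitivity (l ^+ 2 * (Z1 * Z2 * Z3) / Y ^+ 2 - Z1 - Z2).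
      by rewrite /l; field; rewrite X1 X2 X3 Y0 two_neq0.
    by rewrite /Z1 /Z2; ring.
- have -> : s * (a Z1 * a Z2 * a Z3) =
    (l - Y / Z1) * (l - Y / Z2) * (l - Y / Z3) * (Z1 * Z2 * Z3) / Y ^+ 2.
    transitivity ((l - Y / Z1) * (l - Y / Z2) * (l - Y / Z3) * s^-1 ^+ 2).
      by rewrite /a; field; rewrite s0 X1 X2 X3.
    by rewrite sV !mulrA.
  rewrite -yE.
  have -> : l ^+ 2 / c - - (r1 + r2 + r3) - X - X - X =
    l ^+ 2 * (Z1 * Z2 * Z3) / Y ^+ 2 - Z1 - Z2 - Z3.
    transitivity (l ^+ 2 / c - Z1 - Z2 - Z3); first by rewrite /Z1 /Z2 /Z3; ring.
    by rewrite sE sY; field; rewrite X1 X2 X3 Y0.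
  by rewrite /l; field; rewrite X1 X2 X3 Y0 two_neq0.
- rewrite a12 a13 a23; split.
  + transitivity (Y ^+ 2 / s ^+ 2 / (Z2 * Z3)).
      by rewrite sY; field; rewrite X1 X2 X3 Y0.
    by field; rewrite s0 X2 X3.
  + transitivity (Y ^+ 2 / s ^+ 2 / (Z1 * Z3)).
      by rewrite sY; field; rewrite X1 X2 X3 Y0.
    by field; rewrite s0 X1 X3.
  + transitivity (Y ^+ 2 / s ^+ 2 / (Z1 * Z2)).
      by rewrite sY; field; rewrite X1 X2 X3 Y0.
    by field; rewrite s0 X1 X2.
- rewrite a12 a13 a23; split=> //.
  transitivity (Y ^+ 3 / s ^+ 2 / (Z1 * Z2 * Z3)).
    by rewrite sY; field; rewrite X1 X2 X3 Y0.
  by field; rewrite s0 X1 X2 X3.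
Qed.
End Doubling.
End Formulas.

(** * Matching the points of two curves *)

Section SplitCubic.
Variables (L : closedFieldType) (E : cubic_eqn L).
Local Notation f := (cpol E).
Hypothesis smooth : smooth_cubic E.

Lemma splits_exists_at r : root f r -> exists r2 r3, splits_at f r r2 r3.
Proof.
have [_ _ /monicP lead_f size_f ns] := smooth.
have [rs fE] := closed_field_poly_normal f; rewrite lead_f scale1r in fE.
have size_rs : size rs = 3%N.
  by move: size_f; rewrite fE size_prod_XsubC => -[].
rewrite {1}fE root_prod_XsubC => r_rs.
have fE' : f = \prod_(z <- r :: rem r rs) ('X - z%:P).
  by rewrite fE; apply: perm_big; exact: perm_to_rem.
have : size (rem r rs) = 2%N by rewrite size_rem // size_rs.
case: (rem r rs) fE' => [|r2 [|r3 []]] // fE' _; exists r2, r3.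
rewrite !big_cons big_nil mulr1 mulrA in fE'.
have dbl x y : f = ('X - x%:P) * ('X - x%:P) * ('X - y%:P) -> False.
  move=> fxy; apply: (ns x 0).
    by rewrite /= fxy !hornerM !hornerXsubC subrr !mul0r mulr0 expr0n.
  rewrite mulr0; split => //.
  by rewrite fxy !derivM !derivXsubC !(hornerD, hornerM, hornerN, hornerX, hornerC); ring.
split=> //; apply/eqP => e; rewrite ?e in fE'.
- exact: dbl fE'.
- by apply: (dbl r3 r2); rewrite fE'; ring.
- by apply: (dbl r3 r); rewrite fE'; ring.
Qed.

Lemma splits_exists : exists r1 r2 r3, splits_at f r1 r2 r3.
Proof.
have [_ _ _ size_f _] := smooth.
have [|r rf] := @closed_rootP _ f _; first by rewrite size_f.
by have [r2 [r3 fE]] := splits_exists_at rf; exists r, r2, r3.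
Qed.

End SplitCubic.

Section Transfer.
Variables (L : closedFieldType) (v : valuation L).
Local Notation close := (close v).
Local Notation vr := (val_rat v).

(* The last field is hypothesis (2) of the theorem; for r = r' it is trivial. *)
Record matched (E1 E2 : cubic_eqn L) (phi : L -> L) (u : L) : Prop := Matched {
  matched_smooth1 : smooth_cubic E1;
  matched_smooth2 : smooth_cubic E2;
  matched_scale : ccst E1 = u ^+ 2 * ccst E2;
  matched_root : forall r, root (cpol E1) r -> root (cpol E2) (phi r);
  matched_inj : forall r r', root (cpol E1) r -> root (cpol E1) r' ->
    phi r = phi r' -> r = r';
  matched_close : forall r r', root (cpol E1) r -> root (cpol E1) r' ->
    close (r - r') (phi r - phi r')
}.

(* The matching of points P = (x, y) of E1 with points P' = (x', y') of E2: as
   c1 = u^2 c2, the condition on the x - r implies y ~ u y' up to sign. *)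
Definition sim (E1 : cubic_eqn L) (phi : L -> L) (u : L) (P P' : ec_point L) :=
  match P, P' with
  | None, None => True
  | Some (x, y), Some (x', y') =>
      (forall r, root (cpol E1) r -> close (x - r) (x' - phi r)) /\
      close y (u * y')
  | _, _ => False
  end.

Section Matched.
Variables (E1 E2 : cubic_eqn L) (phi : L -> L) (u : L).
Hypothesis match12 : matched E1 E2 phi u.
Local Notation c1 := (ccst E1).
Local Notation c2 := (ccst E2).
Local Notation f1 := (cpol E1).
Local Notation f2 := (cpol E2).
Hypothesis val2 : vr 2%:R = 0.

Let smooth1 := matched_smooth1 match12.
Let smooth2 := matched_smooth2 match12.

Let two_neq0 : 2%:R != 0 :> L. Proof. by case: smooth1. Qed.
Let c1_neq0 : c1 != 0. Proof. by case: smooth1. Qed.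
Let c2_neq0 : c2 != 0. Proof. by case: smooth2. Qed.
Let u_neq0 : u != 0.
Proof.
by apply: contraNneq c1_neq0 => u0; rewrite (matched_scale match12) u0 expr0n mul0r.
Qed.

Lemma splits_matched r1 r2 r3 : splits_at f1 r1 r2 r3 ->
  splits_at f2 (phi r1) (phi r2) (phi r3).
Proof.
move=> fE; have f1_root r := splits_root r fE.
have [rt1 rt2 rt3] : [/\ root f1 r1, root f1 r2 & root f1 r3].
  by split; rewrite f1_root eqxx ?orbT.
have neq r r' : root f1 r -> root f1 r' -> r != r' -> phi r != phi r'.
  move=> rt rt'; apply: contra_neq; exact: (matched_inj match12 rt rt').
case: fE => _ r12 r13 r23.
have [_ _ /monicP lead_f2 size_f2 _] := smooth2.
have p12 := neq _ _ rt1 rt2 r12; have p13 := neq _ _ rt1 rt3 r13.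
have p23 := neq _ _ rt2 rt3 r23.
split=> //.
rewrite (@all_roots_prod_XsubC _ f2 [:: phi r1; phi r2; phi r3]) ?size_f2 //.
- by rewrite lead_f2 scale1r !big_cons big_nil mulr1 mulrA.
- by rewrite /= !(matched_root match12).
- by rewrite uniq_rootsE /= !inE negb_or p12 p13 p23.
Qed.

Lemma sim_neg P P' : sim E1 phi u P P' -> sim E1 phi u (ec_neg P) (ec_neg P').
Proof.
case: P P' => [[x y]|] [[x' y']|] //= [cx cy]; split=> //.
by rewrite mulrN; exact: closeN.
Qed.

(* The half of P given by the square roots a_i of x - r_i is matched with the
   half of P' given by the square roots of x' - phi(r_i) close to the a_i. *)
Lemma sim_half P P' Q : on_curve E2 P' -> on_curve E1 Q -> ec_add E1 Q Q = P ->
  sim E1 phi u P P' ->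
  exists Q', [/\ on_curve E2 Q', ec_add E2 Q' Q' = P' & sim E1 phi u Q Q'].
Proof.
move=> onP' onQ QP PP'; have [r1 [r2 [r3 fE]]] := splits_exists smooth1.
have fE' := splits_matched fE; have f1_root r := splits_root r fE.
have [rt1 rt2 rt3] : [/\ root f1 r1, root f1 r2 & root f1 r3].
  by split; rewrite f1_root eqxx ?orbT.
have closeR := matched_close match12.
case: P QP PP' => [[x y]|] QP; last first.
  case: P' onP' => // _ _; case: Q onQ QP => [[X Y]|] onQ; last by exists None.
  rewrite /= eqxx; case: eqVneq => // /eqP + _; rewrite (eq_opp smooth1) => /eqP Y0.
  move/eqP: onQ.
  rewrite Y0 expr0n => /esym/eqP; rewrite mulf_eq0 (negbTE c1_neq0) /= => rX.
  exists (Some (phi X, 0)); split.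
  - exact: root_on_curve (matched_root match12 rX).
  - by rewrite /= oppr0 !eqxx.
  - by split=> [r rt|]; [exact: closeR|rewrite mulr0; exact: close_refl].
case: P' onP' => [[x' y']|] // onP' [xx' yy'].
case: Q onQ QP => [[X Y]|] // onQ QP.
have sqrt z : exists s, s ^+ 2 = z :> L.
  have [|s] := @closed_rootP L ('X^2 - z%:P) _; first by rewrite size_XnsubC.
  by rewrite rootE !hornerE subr_eq0 => /eqP; exists s.
have [s sE] := sqrt c2; have sE1 : c1 = (u * s) ^+ 2.
  by rewrite exprMn sE (matched_scale match12).
have s0 : s != 0 by apply: contraNneq c2_neq0 => s0; rewrite -sE s0 expr0n.
have [a1 [a2 [a3 [[a1E a2E a3E] yE [X1E X2E X3E] [YE Y0]]]]] :=
  ec_half_roots smooth1 fE sE1 onQ QP.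
have lift a r : root f1 r -> a ^+ 2 = x - r ->
    exists2 a', close a a' & a' ^+ 2 = x' - phi r.
  move=> rt aE; have [b bE] := sqrt (x' - phi r).
  have : close (a ^+ 2) (b ^+ 2) by rewrite aE bE; exact: xx'.
  by case/close_sqrt => //; [exists b|exists (- b); rewrite ?sqrrN].
have [b1 ab1 b1E] := lift a1 r1 rt1 a1E.
have [b2 ab2 b2E] := lift a2 r2 rt2 a2E.
have [b3 ab3 b3E] := lift a3 r3 rt3 a3E.
have sum a b r a' b' r' : root f1 r -> root f1 r' -> 
    a ^+ 2 = x - r -> b ^+ 2 = x' - phi r ->
    a' ^+ 2 = x - r' -> b' ^+ 2 = x' - phi r' -> close a b -> close a' b' ->
    close (a + a') (b + b').
  move=> rt rt' aE bE a'E b'E ab ab'; apply: close_sqrD => //.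
  rewrite aE bE a'E b'E (_ : x - r - _ = r' - r); last by ring.
  by rewrite (_ : x' - phi r - _ = phi r' - phi r); [exact: closeR|ring].
have ab12 : close (a1 + a2) (b1 + b2) by apply: (sum _ _ r1 _ _ r2).
have ab13 : close (a1 + a3) (b1 + b3) by apply: (sum _ _ r1 _ _ r3).
have ab23 : close (a2 + a3) (b2 + b3) by apply: (sum _ _ r2 _ _ r3).
move: Y0; rewrite YE !mulf_eq0 !negb_or -!andbA => /and5P[_ _ a12 a13 a23].
have [onQ' QQ'] := ec_half smooth2 fE' (esym sE) b1E b2E b3E
  (etrans (esym (congr1 negb (close_eq0 ab12))) a12)
  (etrans (esym (congr1 negb (close_eq0 ab13))) a13)
  (etrans (esym (congr1 negb (close_eq0 ab23))) a23) erefl erefl.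
eexists; split; [exact: onQ'| |].
- rewrite QQ'; congr (Some (_, _)).
  have on' := splits_on_curve fE' onP'.
  (* The b_i determine y' only up to sign; closeness to y excludes the wrong sign unless y' = 0. *)
  have cb : close (u * y') (u * (s * (b1 * b2 * b3))).
    apply: close_trans (close_sym yy') _; rewrite yE -!mulrA.
    apply: closeM (close_refl v u) _; apply: closeM (close_refl v s) _.
    exact: closeM ab1 (closeM ab2 ab3).
  have : (s * (b1 * b2 * b3)) ^+ 2 = y' ^+ 2.
    by rewrite on' -sE -b1E -b2E -b3E; ring.
  move/eqP; rewrite eqf_sqr => /orP[/eqP //|/eqP e].
  move: cb; rewrite e mulrN => cb.
  have /eqP := close_opp two_neq0 val2 (close_refl v _) cb.
  by rewrite mulf_eq0 (negbTE u_neq0) /= => /eqP ->; rewrite oppr0.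
- split=> [r|]; last first.
    rewrite -!mulrA; apply: closeM (close_refl v u) _.
    apply: closeM (close_refl v s) _; exact: closeM ab12 (closeM ab13 ab23).
  have p1 : phi r1 = x' - b1 ^+ 2 by rewrite b1E; ring.
  have p2 : phi r2 = x' - b2 ^+ 2 by rewrite b2E; ring.
  have p3 : phi r3 = x' - b3 ^+ 2 by rewrite b3E; ring.
  rewrite f1_root => /or3P[] /eqP ->.
  + by rewrite X1E addrAC subrr add0r; exact: closeM ab12 ab13.
  + rewrite X2E (_ : _ - phi r2 = (b1 + b2) * (b2 + b3)); first exact: closeM ab12 ab23.
    by rewrite p1 p2; ring.
  + rewrite X3E (_ : _ - phi r3 = (b1 + b3) * (b2 + b3)); first exact: closeM ab13 ab23.
    by rewrite p1 p3; ring.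
Qed.
End Matched.
End Transfer.

(** * Rigidity: torsion points matched by the identity coincide *)

Section TorsionReduction.
Variables (L : closedFieldType) (v : valuation L) (E : cubic_eqn L).
Local Notation close := (close v).
Local Notation vr := (val_rat v).
Local Notation c := (ccst E).
Local Notation f := (cpol E).
Hypothesis smooth : smooth_cubic E.
Hypothesis val2 : vr 2%:R = 0.

Let two_neq0 : 2%:R != 0 :> L. Proof. by case: smooth. Qed.
Let c_neq0 : c != 0. Proof. by case: smooth. Qed.

(* The points reducing to infinity on a minimal semistable model: they form a
   subgroup without 2-torsion, as doubling preserves the valuations of the x - r. *)
Definition near_infinity (P : ec_point L) :=
  if P is Some (x, _) then forall r r' r'', root f r -> root f r' -> root f r'' ->
    r' != r'' -> x != r /\ vr (x - r) < vr (r' - r'')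
  else False.

(** The X - r_i are ~ to one another, so the three sums a_i + a_j have the same valuation, half of
    v(X - r). Then 2 a1 - (a1 + a2) = (r2 - r) / (a1 + a2) is of larger valuation, so that a1 + a2 ~
    2 a1 and v(x - r) = 2 v(a1) = v(X - r). *)
Lemma near_infinity_double P : on_curve E P -> near_infinity P ->
  near_infinity (ec_add E P P).
Proof.
case: P => [[X Y]|] // onP near.
have [s sE] : exists s, c = s ^+ 2.
  have [|s] := @closed_rootP L ('X^2 - c%:P) _; first by rewrite size_XnsubC.
  by rewrite rootE !hornerE subr_eq0 => /eqP; exists s.
case PP: (ec_add E (Some (X, Y)) (Some (X, Y))) => [[x y]|]; last first.
  move: PP; rewrite /= eqxx; case: eqVneq => // /eqP + _.
  rewrite (eq_opp smooth) => /eqP Y0.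
  have [r1 [r2 [r3 fE]]] := splits_exists smooth.
  have f_root r := splits_root r fE; have [_ r12 _ _] := fE.
  move/eqP: onP; rewrite Y0 expr0n => /esym/eqP.
  rewrite mulf_eq0 (negbTE c_neq0) /= => rX.
  by have [] := near X r1 r2 rX; rewrite ?f_root ?eqxx ?orbT.
move=> r r' r'' rt rt' rt'' r'r''.
have [r2 [r3 fE]] := splits_exists_at smooth rt.
have f_root z := splits_root z fE; have [_ r12 r13 r23] := fE.
have rt2 : root f r2 by rewrite f_root eqxx orbT.
have rt3 : root f r3 by rewrite f_root eqxx !orbT.
have [a1 [a2 [a3 [[a1E a2E _] _ [X1E X2E X3E] _]]]] :=
  ec_half_roots smooth fE sE onP PP.
have nz z : root f z -> X - z != 0.
  by move=> rz; rewrite subr_eq0; have [] := near z r' r'' rz rt' rt'' r'r''.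
have Xclose z : root f z -> r != z -> close (X - r) (X - z).
  move=> rz rz'; apply/close_sub; first exact: nz.
  exists (vr (r - z)); first by have [] := near r r z rt rt rz rz'.
  by rewrite (_ : _ - _ = r - z) ?val_ge_fin ?subr_eq0 //; ring.
have v2 := close_val (Xclose _ rt2 r12); have v3 := close_val (Xclose _ rt3 r13).
have := nz _ rt; rewrite X1E mulf_eq0 negb_or => /andP[a12 a13].
have := nz _ rt2; rewrite X2E mulf_eq0 negb_or => /andP[_ a23].
rewrite X1E X2E !val_ratM // in v2; rewrite X1E X3E !val_ratM // in v3.
have vX1 : vr (X - r) = vr (a1 + a2) + vr (a1 + a3) by rewrite X1E val_ratM.
have nr := (near r r r2 rt rt rt2 r12).2.
have a1close : close (a1 + a2) (2%:R * a1).
  apply/close_sub => //; exists (vr (r2 - r) - vr (a1 + a2)).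
    have -> : vr (r2 - r) = vr (r - r2) by rewrite -val_ratN opprB.
    by lra.
  rewrite (_ : 2%:R * a1 - _ = (r2 - r) / (a1 + a2)); last first.
    have -> : r2 - r = a1 ^+ 2 - a2 ^+ 2 by rewrite a1E a2E; ring.
    by field.
  by apply: val_geM; rewrite val_ge_fin ?invr_eq0 ?val_ratV // subr_eq0 eq_sym.
have a10 : a1 != 0.
  have := close_eq0 a1close; rewrite (negbTE a12) mulf_eq0 (negbTE two_neq0).
  by move=> /esym/negbT.
have va1 : vr a1 = vr (a1 + a2) by rewrite (close_val a1close) val_ratM // val2 add0r.
have vx : vr (x - r) = vr (X - r).
  by rewrite -a1E expr2 val_ratM //; lra.
split; first by rewrite -subr_eq0 -a1E expf_neq0.
by rewrite vx; have [] := near r r' r'' rt rt' rt'' r'r''.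
Qed.

Lemma near_infinity_not_tors P : ec_tors E P -> ~ near_infinity P.
Proof.
move: P; apply: (ec_tors_ind smooth); first by [].
by move=> P [onP _] IH near; apply: IH; exact: near_infinity_double.
Qed.

(** For P - Q the line has numerator y1 (x2 - r) + y2 (x1 - r) ~ 2 y1 (x1 - r), free of
    cancellation. Hence v(x3 - r) is the sum of the three v(x1 - r_i) minus 2 v(x2 - x1). As v(x2 -
    x1) exceeds each v(x1 - r_i), this is less than each of them, and so less than v(r' - r'') by
    the ultrametric inequality. *)
Lemma sim_near_infinity P Q : on_curve E P -> on_curve E Q ->
  sim v E id 1 P Q -> P <> Q -> near_infinity (ec_add E P (ec_neg Q)).
Proof.
case: P Q => [[x1 y1]|] [[x2 y2]|] // onP onQ [cx cy] PQ.
rewrite mul1r in cy.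
have [x12|x12] := eqVneq x1 x2.
  rewrite -x12 in onQ PQ; case: (on_curve_x_opp onP onQ) => e.
    by case: PQ; rewrite x12 e.
  have y20 : y2 = 0.
    apply: (close_opp two_neq0 val2 (close_refl v _)).
    by apply: close_sym; rewrite -e.
  by case: PQ; rewrite e y20 oppr0 x12.
have onN : on_curve E (Some (x2, - y2)) := ec_neg_on_curve onQ.
have D0 : x2 - x1 != 0 by rewrite subr_eq0 eq_sym.
case PQ': (ec_add E _ _) => [[x3 y3]|]; last by move: PQ'; rewrite /= (negbTE x12).
have [rootE _] := ec_add_root smooth onP onN x12 PQ'.
have nz r : root f r -> (x1 - r != 0) /\ (x2 - r != 0).
  move=> rt; have e : (x1 - r == 0) = (x2 - r == 0) := close_eq0 (cx r rt).
  have [e1|n1] := eqVneq (x1 - r) 0; last by rewrite -e.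
  have e2 : x2 - r = 0 by apply/eqP; rewrite -e e1.
  by case/eqP: x12; rewrite -[LHS](subrK r) e1 -e2 subrK.
have vD r : root f r -> vr (x1 - r) < vr (x2 - x1).
  move=> rt; have [n1 n2] := nz r rt.
  have /close_sub := cx r rt => /(_ n1)[q ltq].
  rewrite (_ : _ - _ = x2 - x1); last by ring.
  by rewrite val_ge_fin //; exact: lt_le_trans.
move=> r r' r'' rt rt' rt'' r'r''.
have [r2 [r3 fE]] := splits_exists_at smooth rt'.
have f_root z := splits_root z fE; have [_ r12 r13 r23] := fE.
have rt2 : root f r2 by rewrite f_root eqxx orbT.
have rt3 : root f r3 by rewrite f_root eqxx !orbT.
have y1E := splits_on_curve fE onP.
have [n1 _] := nz _ rt'; have [n2 _] := nz _ rt2; have [n3 _] := nz _ rt3.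
have y10 : y1 != 0.
  by rewrite -sqrf_eq0 y1E !mulf_neq0.
have vy1 : vr y1 + vr y1 = vr c + (vr (x1 - r') + vr (x1 - r2) + vr (x1 - r3)).
  by rewrite -val_ratM // -expr2 y1E !val_ratM ?mulf_neq0.
have [m1 m2] := nz _ rt.
have num : close (2%:R * (y1 * (x1 - r))) (y1 * (x2 - r) - - y2 * (x1 - r)).
  rewrite mulNr opprK; apply: closeD2 => //; apply: closeM; first exact: close_refl.
  - exact: cx.
  - exact: cy.
  - exact: close_refl.
have num0 : y1 * (x2 - r) - - y2 * (x1 - r) != 0.
  by rewrite -(close_eq0 num) !mulf_neq0.
have vnum : vr (y1 * (x2 - r) - - y2 * (x1 - r)) = vr y1 + vr (x1 - r).
  by rewrite -(close_val num) !val_ratM ?mulf_neq0 // val2 add0r.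
have := rootE r rt => eqr.
have x30 : x3 - r != 0.
  apply: contraNneq num0 => x30; rewrite -sqrf_eq0 -eqr x30; apply/eqP; ring.
have vx3 : vr c + vr (x1 - r) + vr (x2 - r) + vr (x3 - r) +
      (vr (x2 - x1) + vr (x2 - x1)) =
    (vr y1 + vr (x1 - r)) + (vr y1 + vr (x1 - r)).
  by have := congr1 vr eqr; rewrite !expr2 !val_ratM ?mulf_neq0 // vnum.
have v12 := close_val (cx r rt); rewrite /= in v12.
split; first by rewrite -subr_eq0.
have lt' := vD _ rt'; have lt2 := vD _ rt2; have lt3 := vD _ rt3.
have sep z : root f z -> r' != z -> Num.min (vr (x1 - r')) (vr (x1 - z)) <= vr (r' - z).
  move=> rz nez; have [nz1 _] := nz _ rz; rewrite -val_ge_fin ?subr_eq0 //.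
  rewrite (_ : r' - z = (x1 - z) + - (x1 - r')); last by ring.
  by apply: val_geD; rewrite ?val_geN val_ge_fin // ge_min lexx ?orbT.
move: (sep _ rt'' r'r''); rewrite ge_min => /orP.
move: (rt''); rewrite f_root => /or3P[] /eqP e; rewrite e in r'r'' *.
- by rewrite eqxx in r'r''.
- by case; lra.
- by case; lra.
Qed.

Lemma sim_tors_eq P Q : ec_tors E P -> ec_tors E Q -> sim v E id 1 P Q -> P = Q.
Proof.
move=> tP tQ PQ; apply: contrapT => neq.
apply: (@near_infinity_not_tors (ec_add E P (ec_neg Q))).
  by apply: ec_tors_add => //; exact: ec_tors_neg.
by apply: sim_near_infinity => //; [case: tP|case: tQ].
Qed.
End TorsionReduction.

(** * Additivity of the matching on 2-power torsion *)

Section SimAdditive.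
Variables (L : closedFieldType) (v : valuation L).
Variables (E1 E2 : cubic_eqn L) (phi : L -> L) (u : L).
Local Notation close := (close v).
Local Notation vr := (val_rat v).
Local Notation c1 := (ccst E1).
Local Notation c2 := (ccst E2).
Local Notation f1 := (cpol E1).
Local Notation f2 := (cpol E2).
Local Notation sim12 := (sim v E1 phi u).
Hypothesis match12 : matched v E1 E2 phi u.
Hypothesis val2 : vr 2%:R = 0.

Let smooth1 := matched_smooth1 match12.
Let smooth2 := matched_smooth2 match12.
Let two_neq0 : 2%:R != 0 :> L. Proof. by case: smooth1. Qed.
Let c1_neq0 : c1 != 0. Proof. by case: smooth1. Qed.
Let c2_neq0 : c2 != 0. Proof. by case: smooth2. Qed.
Let u_neq0 : u != 0.
Proof.
by apply: contraNneq c1_neq0 => u0; rewrite (matched_scale match12) u0 expr0n mul0r.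
Qed.

(** Two matches of P are matched with each other by the identity of E2, so rigidity applies. *)
Lemma sim_uniq P P' P'' : ec_tors E2 P' -> ec_tors E2 P'' ->
  sim12 P P' -> sim12 P P'' -> P' = P''.
Proof.
move=> tP' tP'' s' s''; apply: (sim_tors_eq smooth2 val2) => //.
case: P P' P'' {tP' tP''} s' s'' => [[x y]|] [[x' y']|] [[x'' y'']|] //=.
move=> [xx' yy'] [xx'' yy'']; split=> [b rb|]; last first.
  rewrite mul1r; have := close_trans (close_sym yy') yy''.
  move/(closeM (close_refl v u^-1)).
  by rewrite !mulrA mulVf // !mul1r.
have [r1 [r2 [r3 fE]]] := splits_exists smooth1.
have f_root z := splits_root z fE.
have [r rt ->] : exists2 r, root f1 r & b = phi r.
  move: rb; rewrite (splits_root _ (splits_matched match12 fE)).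
  by case/or3P => /eqP ->; [exists r1|exists r2|exists r3];
    rewrite // f_root eqxx ?orbT.
exact: close_trans (close_sym (xx' r rt)) (xx'' r rt).
Qed.

Lemma sim_exists P : ec_tors E1 P -> exists2 P', ec_tors E2 P' & sim12 P P'.
Proof.
move: P; apply: (ec_tors_ind smooth1).
  by exists None => //; split=> //; exists 0%N.
move=> P [onP _] [R' tR' PR'].
have [P' [onP' P'E PP']] := sim_half match12 val2 (proj1 tR') onP erefl PR'.
by exists P' => //; apply: (ec_tors_half smooth2) => //; rewrite P'E.
Qed.

(** Halving the match of 2P along P yields a match of P, which by uniqueness is P'. *)
Lemma sim_double P P' : ec_tors E1 P -> ec_tors E2 P' -> sim12 P P' ->
  sim12 (ec_add E1 P P) (ec_add E2 P' P').
Proof.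
move=> tP tP' PP'.
have [R' tR' RR'] := sim_exists (ec_tors_add smooth1 tP tP).
have [Q' [onQ' Q'E PQ']] := sim_half match12 val2 (proj1 tR') (proj1 tP) erefl RR'.
suff -> : P' = Q' by rewrite Q'E.
by apply: sim_uniq PP' PQ' => //; apply: (ec_tors_half smooth2) => //; rewrite Q'E.
Qed.

Lemma close_on_curve x y x' y' : on_curve E1 (Some (x, y)) ->
  on_curve E1 (Some (x', y')) ->
  (forall r, root f1 r -> close (x - r) (x' - r)) -> close y y' \/ close y (- y').
Proof.
have [r1 [r2 [r3 fE]]] := splits_exists smooth1.
have f_root z := splits_root z fE.
move=> /(splits_on_curve fE) on /(splits_on_curve fE) on' cx; apply: close_sqrt.
rewrite on on'; apply: closeM (close_refl v _) _.
by do 2?[apply: closeM]; apply: cx; rewrite f_root eqxx ?orbT.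
Qed.

(* Distinct torsion points up to sign are never too close, so that x1 - x2 is
   controlled by some pair x1 - r, x2 - r without cancellation. *)
Lemma sim_subx x1 y1 x1' y1' x2 y2 x2' y2' :
  ec_tors E1 (Some (x1, y1)) -> ec_tors E2 (Some (x1', y1')) ->
  ec_tors E1 (Some (x2, y2)) -> ec_tors E2 (Some (x2', y2')) ->
  sim12 (Some (x1, y1)) (Some (x1', y1')) -> sim12 (Some (x2, y2)) (Some (x2', y2')) ->
  close (x1 - x2) (x1' - x2').
Proof.
move=> t1 t1' t2 t2' s1 s2.
have [x12|x12] := eqVneq x1 x2.
  suff -> : x1' = x2' by rewrite x12 !subrr; exact: close_refl.
  have on2 := proj1 t2; rewrite -x12 in on2 s2.
  case: (on_curve_x_opp (proj1 t1) on2) => y12; rewrite y12 in s1.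
    by case: (sim_uniq t1' t2' s1 s2).
  by case: (sim_uniq t1' (ec_tors_neg smooth2 t2') s1 (sim_neg s2)).
have D0 : x1 - x2 != 0 by rewrite subr_eq0.
have [[r [rt g1 g2]]|none] := pselect (exists r, [/\ root f1 r,
    val_ge v (vr (x1 - x2)) (x1 - r) & val_ge v (vr (x1 - x2)) (x2 - r)]).
  have DE : x1 - x2 = (x1 - r) - (x2 - r) by ring.
  rewrite DE (_ : x1' - x2' = (x1' - phi r) - (x2' - phi r)); last by ring.
  by apply: closeB; rewrite -?DE //; [exact: (proj1 s1)|exact: (proj1 s2)].
(* Without such a root, v(x1 - x2) exceeds v(x1 - r) or v(x2 - r) for every r. Then Q or - Q is
   matched with P by the identity, and rigidity contradicts x1 <> x2. *)
have cx r : root f1 r -> close (x1 - r) (x2 - r).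
  move=> rt; have [g1|ng1] := pselect (val_ge v (vr (x1 - x2)) (x1 - r)).
    have [g2|ng2] := pselect (val_ge v (vr (x1 - x2)) (x2 - r)).
      by case: none; exists r.
    have n2 : x2 - r != 0.
      by apply/eqP => e; apply: ng2; rewrite e; exact: val_ge0.
    apply: close_sym; apply/close_sub => //; exists (vr (x1 - x2)).
      by rewrite ltNge -val_ge_fin //; apply/negP.
    by rewrite (_ : _ - (_ - _) = x1 - x2) ?val_ge_fin //; ring.
  have n1 : x1 - r != 0.
    by apply/eqP => e; apply: ng1; rewrite e; exact: val_ge0.
  apply/close_sub => //; exists (vr (x1 - x2)).
    by rewrite ltNge -val_ge_fin //; apply/negP.
  rewrite (_ : _ - (_ - _) = - (x1 - x2)); last by ring.
  by rewrite val_geN val_ge_fin.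
case: (close_on_curve (proj1 t1) (proj1 t2) cx) => cy.
  have /(sim_tors_eq smooth1 val2 t1 t2) [e _] :
    sim v E1 id 1 (Some (x1, y1)) (Some (x2, y2)) by split; rewrite ?mul1r.
  by rewrite e eqxx in x12.
have /(sim_tors_eq smooth1 val2 t1 (ec_tors_neg smooth1 t2)) [e _] :
  sim v E1 id 1 (Some (x1, y1)) (ec_neg (Some (x2, y2))) by split; rewrite ?mul1r.
by rewrite e eqxx in x12.
Qed.

Lemma sim_add_two_torsion r x y x' y' : root f1 r ->
  ec_tors E1 (Some (x, y)) -> ec_tors E2 (Some (x', y')) ->
  sim12 (Some (x, y)) (Some (x', y')) -> x != r ->
  sim12 (ec_add E1 (Some (x, y)) (Some (r, 0)))
      (ec_add E2 (Some (x', y')) (Some (phi r, 0))).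
Proof.
move=> rt [onP _] [onP' _] [cx cy] xr.
have [r2 [r3 fE]] := splits_exists_at smooth1 rt.
have f_root z := splits_root z fE.
have rt2 : root f1 r2 by rewrite f_root eqxx orbT.
have rt3 : root f1 r3 by rewrite f_root eqxx !orbT.
have xr' : x' != phi r by rewrite -subr_eq0 -(close_eq0 (cx r rt)) subr_eq0.
have [x3 [y3 [-> X1 X2 X3 Y3]]] := ec_add_two_torsion smooth1 fE onP xr.
have [x3' [y3' [-> X1' X2' X3' Y3']]] :=
  ec_add_two_torsion smooth2 (splits_matched match12 fE) onP' xr'.
have cr := matched_close match12.
split=> [z|].
  rewrite f_root => /or3P[] /eqP ->.
  - by rewrite X1 X1'; apply: close_div (cx _ rt); apply: closeM; exact: cr.
  - by rewrite X2 X2'; apply: close_div (cx _ rt); apply: closeM; [exact: cr|exact: cx].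
  - by rewrite X3 X3'; apply: close_div (cx _ rt); apply: closeM; [exact: cr|exact: cx].
rewrite Y3 Y3' (_ : u * _ = - (u * y') * ((phi r - phi r2) * (phi r - phi r3)) /
  (x' - phi r) ^+ 2); last by ring.
apply: close_div; last by apply: closeX; exact: cx.
by apply: closeM; [exact: closeN|apply: closeM; exact: cr].
Qed.

Lemma tors_root r : root f1 r -> ec_tors E1 (Some (r, 0)).
Proof.
move=> rt; apply: (ec_tors_half smooth1); first exact: root_on_curve.
by rewrite /= oppr0 !eqxx; split=> //; exists 0%N.
Qed.

(* Write l_r = y1 (x2 - r) - y2 (x1 - r), whose squares are the x(P + Q) - r up to
   controlled factors. The product of y1 (x2 - r) - y2 (x1 - r) and
   y1 (x2 - r) + y2 (x1 - r) has the factors x1 - x2 and x(Q) - x(P + (r, 0)), both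
   controlled by sim_subx, so that close_sqrB applies to l_r. *)
Lemma sim_add P Q P' Q' : ec_tors E1 P -> ec_tors E2 P' ->
  ec_tors E1 Q -> ec_tors E2 Q' -> sim12 P P' -> sim12 Q Q' ->
  sim12 (ec_add E1 P Q) (ec_add E2 P' Q').
Proof.
move=> tP tP' tQ tQ' sP sQ.
case: P tP sP => [[x1 y1]|] tP sP; last by case: P' tP' sP => // _ _.
case: P' tP' sP => [[x1' y1']|] // tP' sP.
case: Q tQ sQ => [[x2 y2]|] tQ sQ; last by case: Q' tQ' sQ => // _ _.
case: Q' tQ' sQ => [[x2' y2']|] // tQ' sQ.
have [onP _] := tP; have [onQ _] := tQ; have [onP' _] := tP'; have [onQ' _] := tQ'.
have [x12|x12] := eqVneq x1 x2.
  rewrite -x12 in tQ onQ sQ *; case: (on_curve_x_opp onP onQ) => y12.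
    rewrite -y12 in tQ onQ sQ *; rewrite -(sim_uniq tP' tQ' sP sQ).
    exact: sim_double.
  have tN := ec_tors_neg smooth2 tQ'; have sN := sim_neg sQ.
  rewrite /= -y12 in sN; have [e1 e2] := sim_uniq tP' tN sP sN.
  by rewrite e1 e2 /= !eqxx y12 eqxx.
have D := sim_subx tP tP' tQ tQ' sP sQ.
have x12' : x1' != x2' by rewrite -subr_eq0 -(close_eq0 D) subr_eq0.
have [r1 [r2 [r3 fE]]] := splits_exists smooth1.
have f_root z := splits_root z fE.
have root_of x : on_curve E1 (Some (x, 0)) -> root f1 x.
  by move/eqP; rewrite expr0n => /esym/eqP; rewrite mulf_eq0 (negbTE c1_neq0).
have y_root x x' y' : root f1 x -> ec_tors E2 (Some (x', y')) ->
    sim12 (Some (x, 0)) (Some (x', y')) -> (x', y') = (phi x, 0).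
  move=> rx [on' _] [cx cy]; congr pair.
    by apply/eqP; rewrite -subr_eq0 -(close_eq0 (cx x rx)) subrr.
  by have /eqP := close0 cy; rewrite mulf_eq0 (negbTE u_neq0) => /eqP.
(* Points of order two are treated apart, as the later formulas divide by the ordinates and by x1 -
   r and x2 - r. *)
have [y10|y10] := eqVneq y1 0.
  rewrite y10 in tP onP sP *; have rx1 := root_of _ onP.
  have [e1 e2] := y_root _ _ _ rx1 tP' sP; rewrite e1 e2 in tP' onP' *.
  rewrite (ec_addC smooth1) // (ec_addC smooth2) //.
  by apply: sim_add_two_torsion => //; rewrite eq_sym.
have [y20|y20] := eqVneq y2 0.
  rewrite y20 in tQ onQ sQ *; have rx2 := root_of _ onQ.
  have [e1 e2] := y_root _ _ _ rx2 tQ' sQ; rewrite e1 e2.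
  exact: sim_add_two_torsion.
case PQ: (ec_add E1 _ _) => [[x3 y3]|]; last by move: PQ; rewrite /= (negbTE x12).
case PQ': (ec_add E2 _ _) => [[x3' y3']|]; last by move: PQ'; rewrite /= (negbTE x12').
have [A1 B1] := ec_add_root smooth1 onP onQ x12 PQ.
have [A2 B2] := ec_add_root smooth2 onP' onQ' x12' PQ'.
have [cx1 cy1] := sP; have [cx2 cy2] := sQ.
have D' : close (x2 - x1) (x2' - x1').
  by rewrite -(opprB x1) -(opprB x1'); exact: closeN.
have nz x y r : on_curve E1 (Some (x, y)) -> y != 0 -> root f1 r -> x - r != 0.
  move=> /eqP on y0 /rootP fr; rewrite subr_eq0; apply: contra_neq y0 => xr.
  by apply/eqP; rewrite -sqrf_eq0 on xr fr mulr0.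
have line r : root f1 r ->
  close (y1 * (x2 - r) - y2 * (x1 - r))
    (u * (y1' * (x2' - phi r) - y2' * (x1' - phi r))).
  move=> rt; have [s2 [s3 gE]] := splits_exists_at smooth1 rt.
  have gE' := splits_matched match12 gE.
  have x1r : x1 != r by rewrite -subr_eq0; exact: nz onP y10 rt.
  have x1r' : x1' != phi r by rewrite -subr_eq0 -(close_eq0 (cx1 r rt)) subr_eq0.
  have [x4 [y4 [R X4 _ _ _]]] := ec_add_two_torsion smooth1 gE onP x1r.
  have [x4' [y4' [R' X4' _ _ _]]] := ec_add_two_torsion smooth2 gE' onP' x1r'.
  have tT := tors_root rt; have tT' : ec_tors E2 (Some (phi r, 0)).
    apply: (ec_tors_half smooth2).
      exact: root_on_curve (matched_root match12 rt).
    by rewrite /= oppr0 !eqxx; split=> //; exists 0%N.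
  have := sim_add_two_torsion rt tP tP' sP x1r.
  have := ec_tors_add smooth1 tP tT; have := ec_tors_add smooth2 tP' tT'.
  rewrite R R' => t4' t4 s4; have c4 := sim_subx tQ tQ' t4 t4' sQ s4.
  (* Here x and X are abscissas shifted by the root r, and s t / x is the shifted abscissa of P +
     (r, 0); this is the source of the factor x2 - x4. *)
  have prodE (c y Y x X s t : L) : x != 0 -> y ^+ 2 = c * (x * (x + s) * (x + t)) ->
      Y ^+ 2 = c * (X * (X + s) * (X + t)) ->
      (y * X) ^+ 2 - (Y * x) ^+ 2 = c * X * x * (x - X) * (x * (X - s * t / x)).
    by move=> x0 yE YE; rewrite !exprMn yE YE; field.
  have on (E : cubic_eqn L) x y a b d : splits_at (cpol E) a b d ->
      on_curve E (Some (x, y)) ->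
      y ^+ 2 = ccst E * ((x - a) * (x - a + (a - b)) * (x - a + (a - d))).
    move=> aE /(splits_on_curve aE) ->; ring.
  have nx1 : x1 - r != 0 by rewrite subr_eq0.
  have nx1' : x1' - phi r != 0 by rewrite subr_eq0.
  have p := prodE _ _ _ _ _ _ _ nx1 (on _ _ _ _ _ _ gE onP) (on _ _ _ _ _ _ gE onQ).
  have p' := prodE _ _ _ _ _ _ _ nx1' (on _ _ _ _ _ _ gE' onP') (on _ _ _ _ _ _ gE' onQ').
  have pu : (u * (y1' * (x2' - phi r))) ^+ 2 - (u * (y2' * (x1' - phi r))) ^+ 2 =
      c1 * (x2' - phi r) * (x1' - phi r) * (x1' - x2') * ((x1' - phi r) * (x2' - x4')).
    transitivity (u ^+ 2 * ((y1' * (x2' - phi r)) ^+ 2 - (y2' * (x1' - phi r)) ^+ 2)).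
      by ring.
    by rewrite p' -X4' (matched_scale match12); ring.
  rewrite [u * _]mulrBr; apply: close_sqrB => //.
  - by rewrite mulrA; apply: closeM => //; exact: cx2.
  - by rewrite mulrA; apply: closeM => //; exact: cx1.
  rewrite p -X4 pu (_ : x2 - r - (x4 - r) = x2 - x4); last by ring.
  rewrite (_ : x1 - r - (x2 - r) = x1 - x2); last by ring.
  apply: closeM; last exact: closeM (cx1 r rt) c4.
  apply: closeM D; apply: closeM (cx1 r rt); apply: closeM (cx2 r rt).
  exact: close_refl.
have rt1 : root f1 r1 by rewrite f_root eqxx.
have rt2 : root f1 r2 by rewrite f_root eqxx orbT.
have rt3 : root f1 r3 by rewrite f_root eqxx !orbT.
have dx12 : x2 - x1 != 0 by rewrite subr_eq0 eq_sym.
have dx12' : x2' - x1' != 0 by rewrite subr_eq0 eq_sym.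
have nz' y y' : close y (u * y') -> y != 0 -> y' != 0.
  by move=> cy; rewrite (close_eq0 cy) mulf_eq0 negb_or => /andP[].
have y10' := nz' _ _ cy1 y10; have y20' := nz' _ _ cy2 y20.
split=> [r rt|].
  have n1 := nz _ _ _ onP y10 rt; have n2 := nz _ _ _ onQ y20 rt.
  have n1' : x1' - phi r != 0 by rewrite -(close_eq0 (cx1 r rt)).
  have n2' : x2' - phi r != 0 by rewrite -(close_eq0 (cx2 r rt)).
  have -> : x3 - r = (y1 * (x2 - r) - y2 * (x1 - r)) ^+ 2 /
      (c1 * (x1 - r) * (x2 - r) * (x2 - x1) ^+ 2).
    by rewrite -A1 //; field; rewrite c1_neq0 n1 n2 dx12.
  have -> : x3' - phi r = (u * (y1' * (x2' - phi r) - y2' * (x1' - phi r))) ^+ 2 /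
      (c1 * (x1' - phi r) * (x2' - phi r) * (x2' - x1') ^+ 2).
    rewrite exprMn -A2 ?(matched_root match12) // (matched_scale match12).
    by field; rewrite u_neq0 c2_neq0 n1' n2' dx12'.
  apply: close_div; first by apply: closeX; exact: line.
  apply: closeM; last exact: closeX.
  by apply: closeM (cx2 r rt); apply: closeM (cx1 r rt); exact: close_refl.
have yE (y y' y'' d z : L) : y != 0 -> y' != 0 -> d != 0 ->
    - (y * y' * y'') * d ^+ 3 = z -> y'' = - z / (y * y' * d ^+ 3).
  by move=> ? ? ? <-; field; apply/and3P.
rewrite (yE _ _ _ _ _ y10 y20 dx12 (B1 _ _ _ fE)).
rewrite (yE _ _ _ _ _ y10' y20' dx12' (B2 _ _ _ (splits_matched match12 fE))).
set z1 := _ - y2 * _; set z2 := _ - y2 * (_ - r2); set z3 := _ - y2 * (_ - r3).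
set z1' := _ - y2' * _; set z2' := _ - y2' * (_ - phi r2).
set z3' := _ - y2' * (_ - phi r3).
(* Three factors u above and two below leave one u, and every factor is now known up to ~. *)
rewrite (_ : u * _ = - ((u * z1') * (u * z2') * (u * z3')) /
  ((u * y1') * (u * y2') * (x2' - x1') ^+ 3)); last first.
  by field; rewrite u_neq0 y10' y20' dx12'.
apply: close_div.
  by apply: closeN; apply: closeM (line _ rt3); apply: closeM (line _ rt1) (line _ rt2).
by apply: closeM; [exact: closeM|exact: closeX].
Qed.
End SimAdditive.

(** * The isomorphism of Tate modules *)

Section MatchedSym.
Variables (L : closedFieldType) (v : valuation L).
Variables (E1 E2 : cubic_eqn L) (phi : L -> L) (u : L).
Hypothesis match12 : matched v E1 E2 phi u.
Hypothesis val2 : val_rat v 2%:R = 0.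

(** Exchanging the curves turns existence and uniqueness of matches into surjectivity and
    injectivity of the matching. *)
Lemma matched_sym : exists psi w, matched v E2 E1 psi w /\
  forall P P', sim v E1 phi u P P' <-> sim v E2 psi w P' P.
Proof.
have [r1 [r2 [r3 fE]]] := splits_exists (matched_smooth1 match12).
have f_root z := splits_root z fE.
have /choice[psi psiP] (b : L) : exists r, root (cpol E2) b ->
    root (cpol E1) r /\ phi r = b.
  have [|nb] := boolP (root (cpol E2) b); last by exists 0.
  rewrite (splits_root _ (splits_matched match12 fE)) => /or3P[] /eqP ->;
    [exists r1|exists r2|exists r3]; by rewrite f_root eqxx ?orbT.
have psiK r : root (cpol E1) r -> psi (phi r) = r.
  move=> rt; have [rt' e] := psiP _ (matched_root match12 rt).
  exact: (matched_inj match12).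
have [_ c1_neq0 _ _ _] := matched_smooth1 match12.
have u_neq0 : u != 0.
  by apply: contraNneq c1_neq0 => u0; rewrite (matched_scale match12) u0 expr0n mul0r.
exists psi, u^-1; split.
  split; [exact: matched_smooth2 match12|exact: matched_smooth1 match12| | | |].
  - by rewrite (matched_scale match12); field.
  - by move=> b /psiP[].
  - by move=> b b' /psiP[_ {2}<-] /psiP[_ {2}<-] ->.
  - move=> b b' /psiP[rt e] /psiP[rt' e']; apply: close_sym.
    by rewrite -{2}e -{2}e'; exact: matched_close match12 _ _ rt rt'.
move=> [[x y]|] [[x' y']|] //=; split=> -[cx cy]; split.
- by move=> b /psiP[rt e]; apply: close_sym; rewrite -{2}e; exact: cx.
- by apply: close_sym; have := closeM (close_refl v u^-1) cy; rewrite mulKf.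
- move=> r rt; apply: close_sym; rewrite -{2}(psiK r rt).
  exact: cx (matched_root match12 rt).
- by apply: close_sym; have := closeM (close_refl v u) cy; rewrite mulVKf.
Qed.

Lemma sim_onto P' : ec_tors E2 P' -> exists2 P, ec_tors E1 P & sim v E1 phi u P P'.
Proof.
have [psi [w [match21 simE]]] := matched_sym.
by move=> /(sim_exists match21 val2)[P tP sP]; exists P; rewrite ?simE.
Qed.

Lemma sim_inj P Q P' : ec_tors E1 P -> ec_tors E1 Q ->
  sim v E1 phi u P P' -> sim v E1 phi u Q P' -> P = Q.
Proof.
have [psi [w [match21 simE]]] := matched_sym.
by move=> tP tQ /simE sP /simE sQ; exact: (sim_uniq match21 val2 tP tQ sP sQ).
Qed.

(** The default [None] can be reached only outside the 2-power torsion of E1, where a match may fail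
    to exist. *)
Definition torsion_map (P : ec_point L) : ec_point L :=
  xget None [set P' | ec_tors E2 P' /\ sim v E1 phi u P P'].

Let smooth1 := matched_smooth1 match12.
Let smooth2 := matched_smooth2 match12.

Lemma torsion_mapP P : ec_tors E1 P ->
  ec_tors E2 (torsion_map P) /\ sim v E1 phi u P (torsion_map P).
Proof.
move=> /(sim_exists match12 val2)[P' tP' sP'].
rewrite /torsion_map; case: xgetP => [Q -> [] //|].
by move/(_ P') => []; split.
Qed.

Lemma torsion_map_eq P P' : ec_tors E1 P -> ec_tors E2 P' ->
  sim v E1 phi u P P' -> torsion_map P = P'.
Proof.
move=> tP tP' sP'; have [tQ sQ] := torsion_mapP tP.
exact: (sim_uniq match12 val2 tQ tP' sQ sP').
Qed.

Lemma ec_tors_None (E : cubic_eqn L) : ec_tors E None.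
Proof. by split=> //; exists 0%N. Qed.

Lemma torsion_map_None : torsion_map None = None.
Proof. by apply: torsion_map_eq => //; exact: ec_tors_None. Qed.

Lemma torsion_map_add P Q : ec_tors E1 P -> ec_tors E1 Q ->
  torsion_map (ec_add E1 P Q) = ec_add E2 (torsion_map P) (torsion_map Q).
Proof.
move=> tP tQ; have [tP' sP] := torsion_mapP tP; have [tQ' sQ] := torsion_mapP tQ.
apply: torsion_map_eq; [exact: ec_tors_add|exact: ec_tors_add|].
exact: (sim_add match12 val2).
Qed.

Lemma ec_tors_mul n P : ec_tors E1 P -> ec_tors E1 (ec_mul E1 n P).
Proof.
move=> tP; elim: n => [|n IHn]; first exact: ec_tors_None.
by rewrite ec_mulS; exact: ec_tors_add.
Qed.

Lemma torsion_map_mul n P : ec_tors E1 P ->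
  torsion_map (ec_mul E1 n P) = ec_mul E2 n (torsion_map P).
Proof.
move=> tP; elim: n => [|n IHn]; first exact: torsion_map_None.
by rewrite !ec_mulS torsion_map_add ?IHn //; exact: ec_tors_mul.
Qed.

Lemma torsion_map_inj P Q : ec_tors E1 P -> ec_tors E1 Q ->
  torsion_map P = torsion_map Q -> P = Q.
Proof.
move=> tP tQ e; have [_ sP] := torsion_mapP tP; have [_ sQ] := torsion_mapP tQ.
by rewrite -e in sQ; exact: sim_inj sP sQ.
Qed.

Lemma tate2_tors (E : cubic_eqn L) t n : tate2 E t -> ec_tors E (t n).
Proof. by move=> /(_ n)[[on nt] _]; split=> //; exists n. Qed.

Lemma torsion_map_tate2_bij :
  set_bij (tate2 E1) (tate2 E2) (fun t n => torsion_map (t n)).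
Proof.
split.
- move=> t tt n; have tn := tate2_tors n tt; have tn1 := tate2_tors n.+1 tt.
  have [[_ nt] mt] := tt n; split; last by rewrite -torsion_map_mul // mt.
  split; first by have [[]] := torsion_mapP tn.
  by rewrite -torsion_map_mul // nt torsion_map_None.
- move=> s t; rewrite !inE => ss tt e; apply/funext => n.
  apply: torsion_map_inj; [exact: tate2_tors|exact: tate2_tors|].
  exact: (congr1 (fun h => h n) e).
- move=> t' tt'.
  have /choice[t tP] n : exists P, ec_tors E1 P /\ sim v E1 phi u P (t' n).
    by have [P tP sP] := sim_onto (tate2_tors n tt'); exists P.
  have tE n : torsion_map (t n) = t' n.
    by have [tn sn] := tP n; apply: torsion_map_eq => //; exact: tate2_tors.
  exists t; last by apply/funext => n; exact: tE.
  move=> n; have [tn _] := tP n; have [tn1 _] := tP n.+1; have [[_ nt] mt] := tt' n.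
  (* Torsion and compatibility of the preimages are pulled back through the injectivity of
     [torsion_map]. *)
  split; first split; first by case: tn.
    apply: torsion_map_inj; [exact: ec_tors_mul|exact: ec_tors_None|].
    by rewrite torsion_map_mul // tE nt torsion_map_None.
  apply: torsion_map_inj => //; first exact: ec_tors_mul.
  by rewrite torsion_map_mul // !tE.
Qed.
End MatchedSym.

(** * Compatibility with the Galois action *)

Section Galois.
Variables (K : fieldType) (L : closedFieldType) (iota : {rmorphism K -> L}).
Variables (v : valuation K) (w : valuation L).
Hypothesis v_complete : val_complete v.
Hypothesis L_alg : algebraic_closure iota.
Hypothesis w_ext : val_extends iota v w.
Variable sigma : {rmorphism L -> L}.
Hypothesis sigma_gal : abs_galois iota sigma.

(** The conjugate of w by sigma is a second extension of v, to be compared with w. *)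
Lemma galois_valuation : exists w' : valuation L, forall x, w' x = w (sigma x).
Proof.
have neq_ninfty x : w (sigma x) <> -oo%E by exact: val_neq_ninfty.
have pinfty x : w (sigma x) = +oo%E <-> x = 0.
  rewrite (val_pinfty w (sigma x)); split=> [/eqP|->]; last exact: rmorph0.
  by rewrite fmorph_eq0 => /eqP.
have mul x y : w (sigma (x * y)) = (w (sigma x) + w (sigma y))%E.
  by rewrite rmorphM val_mul.
have add x y : (Order.min (w (sigma x)) (w (sigma y)) <= w (sigma (x + y)%R))%E.
  by rewrite rmorphD val_add.
by exists (Valuation neq_ninfty pinfty mul add).
Qed.

(* Completeness enters only here: it makes the Galois action compatible with w. *)
Lemma close_galois a b : close w a b -> close w (sigma a) (sigma b).
Proof.
move=> [t [mt ->]]; exists (sigma t); split; last exact: rmorphM.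
rewrite -(rmorph1 sigma) -rmorphB.
have [->|t1] := eqVneq (t - 1) 0.
  by rewrite rmorph0; apply/maximal_idealP; exists 1; rewrite ?val_ge0.
have [w' w'E] := galois_valuation.
apply/maximal_ideal_fin; first by rewrite fmorph_eq0.
move/(maximal_ideal_fin w t1): mt => /lt_le_trans; apply.
have -> : val_rat w (sigma (t - 1)) = val_rat w' (t - 1) by rewrite /val_rat w'E.
apply: (val_ext_le v_complete w_ext) => // a'.
by rewrite w'E (proj2 sigma_gal).
Qed.

Lemma map_poly_galois (q : {poly K}) : map_poly sigma (map_poly iota q) = map_poly iota q.
Proof.
by rewrite -map_poly_comp; apply: eq_map_poly => a /=; rewrite (proj2 sigma_gal).
Qed.

Variable E : cubic_eqn K.
Local Notation EL := (base_change iota E).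

Lemma horner_galois (q : {poly K}) x :
  sigma (map_poly iota q).[x] = (map_poly iota q).[sigma x].
Proof. by rewrite -horner_map /= map_poly_galois. Qed.

Lemma root_galois r : root (cpol EL) (sigma r) = root (cpol EL) r.
Proof. by rewrite !rootE /= -horner_galois fmorph_eq0. Qed.

Lemma on_curve_galois P : on_curve EL P -> on_curve EL (gal_point sigma P).
Proof.
case: P => [[x y]|] //= /eqP on; rewrite -horner_galois -rmorphXn on rmorphM.
by rewrite (proj2 sigma_gal).
Qed.

Lemma ec_add_galois P Q :
  gal_point sigma (ec_add EL P Q) = ec_add EL (gal_point sigma P) (gal_point sigma Q).
Proof.
have third l x y x' : gal_point sigma (ec_third EL l x y x') =
    ec_third EL (sigma l) (sigma x) (sigma y) (sigma x').
  rewrite /ec_third /= !coef_map /=.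
  rewrite !(rmorphN, rmorphD, rmorphM, rmorphB, rmorphXn, fmorphV) /=.
  by rewrite !(proj2 sigma_gal).
case: P Q => [[x y]|] [[x' y']|] //=.
rewrite (inj_eq (fmorph_inj sigma)) -rmorphN (inj_eq (fmorph_inj sigma)).
case: eqP => _; last by rewrite third !(rmorphM, rmorphB, fmorphV).
case: eqP => _ //; rewrite third !(rmorphM, rmorphB, fmorphV) rmorph_nat.
by rewrite (proj2 sigma_gal) !deriv_map horner_galois.
Qed.

Lemma ec_tors_galois P : ec_tors EL P -> ec_tors EL (gal_point sigma P).
Proof.
move=> [on [n nP]]; split; first exact: on_curve_galois.
exists n; rewrite -[RHS]/(gal_point sigma None) -nP.
by elim: (2 ^ n)%N => // m IHm; rewrite !ec_mulS IHm ec_add_galois.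
Qed.

Lemma sim_galois phi u P P' :
  (forall r, root (cpol EL) r -> phi (sigma r) = sigma (phi r)) -> sigma u = u ->
  sim w EL phi u P P' -> sim w EL phi u (gal_point sigma P) (gal_point sigma P').
Proof.
case: P P' => [[x y]|] [[x' y']|] // phi_sigma sigma_u [cx cy]; split=> [r|].
  have [[tau _ tauK] _] := sigma_gal.
  rewrite -[r]tauK root_galois => rt; rewrite phi_sigma // -!rmorphB.
  exact: close_galois (cx _ rt).
by rewrite -{1}sigma_u -rmorphM; exact: close_galois.
Qed.
End Galois.

Lemma elliptic_smooth (K : fieldType) (L : closedFieldType)
    (iota : {rmorphism K -> L}) (c : K) (f : {poly K}) :
  2%:R != 0 :> L -> elliptic iota c f -> smooth_cubic (base_change iota (CubicEqn c f)).
Proof.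
move=> two [c0 fm sf ns]; split=> //=; first by rewrite fmorph_eq0.
  by rewrite map_monic.
by rewrite size_map_poly.
Qed.

(** For odd p, 1 = p - 2 (p - 1)/2 would lie in m if 2 did; so 2 is a unit. *)
Lemma val_two_odd_residue (F : fieldType) (v : valuation F) p :
  maximal_ideal v p%:R -> odd p -> 2%:R != 0 :> F /\ val_rat v 2%:R = 0.
Proof.
move=> mp p_odd; have v1 : val_ge v 0 1 by rewrite val_ge_fin ?oner_neq0 // val_rat1.
have nat_ge n : val_ge v 0 n%:R.
  by elim: n => [|n IHn]; [exact: val_ge0|rewrite -natr1; exact: val_geD].
have not_m2 : ~ maximal_ideal v 2%:R.
  move=> m2; apply: (@maximal_ideal1 _ v).
  have -> : 1 = p%:R - p./2%:R * 2%:R :> F.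
    by rewrite -{1}(odd_double_half p) p_odd -muln2 natrD natrM /=; ring.
  by apply: maximal_idealD => //; apply: maximal_idealN; apply: maximal_idealM.
have two_neq0 : 2%:R != 0 :> F.
  apply/eqP => e; apply: not_m2; rewrite e.
  by apply/maximal_idealP; exists 1; rewrite ?val_ge0.
split=> //; apply/eqP; rewrite eq_le -(val_ge_fin v 0 two_neq0) nat_ge andbT leNgt.
by apply/negP => /(maximal_ideal_fin v two_neq0).
Qed.

Theorem theorem1 (K : fieldType) (v : valuation K) (varpi : K) (p : nat)
    (v_discrete : normalised_discrete v varpi)
    (v_complete : val_complete v)
    (v_char : residue_char v p) (p_odd : odd p)
    (Kbar : closedFieldType) (iota : {rmorphism K -> Kbar})
    (Kbar_alg : algebraic_closure iota)
    (vbar : valuation Kbar) (vbar_ext : val_extends iota v vbar)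
    (c1 c2 : K) (f1 f2 : {poly K})
    (ell1 : elliptic iota c1 f1) (ell2 : elliptic iota c2 f2)
    (c_square : exists u : K, u != 0 /\ c1 / c2 = u ^+ 2)
    (phi : Kbar -> Kbar)
    (phi_bij : set_bij (geom_roots iota f1) (geom_roots iota f2) phi)
    (phi_equiv : forall (sigma : {rmorphism Kbar -> Kbar}) (r : Kbar),
        abs_galois iota sigma -> geom_roots iota f1 r ->
        phi (sigma r) = sigma (phi r))
    (phi_close : forall r s : Kbar,
        geom_roots iota f1 r -> geom_roots iota f1 s -> r != s ->
        maximal_ideal vbar ((phi r - phi s) / (r - s) - 1)) :
  tate2_isomorphic iota (CubicEqn c1 f1) (CubicEqn c2 f2).
Proof.
set E1 := base_change iota (CubicEqn c1 f1); set E2 := base_change iota (CubicEqn c2 f2).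
have mp : maximal_ideal vbar p%:R.
  have [_] := v_char; rewrite /maximal_ideal /= -(rmorph_nat iota) => mp.
  by rewrite vbar_ext.
have [two_neq0 val2] := val_two_odd_residue mp p_odd.
have [u [u_neq0 uE]] := c_square.
have [c2_neq0 _ _ _] := ell2.
have [phi_fun phi_inj _] := phi_bij.
have match12 : matched vbar E1 E2 phi (iota u).
  split; [exact: elliptic_smooth ell1|exact: elliptic_smooth ell2| | | |].
  - by rewrite /= -rmorphXn -rmorphM -uE divfK.
  - by move=> r; exact: phi_fun.
  - by move=> r r' rt rt'; apply: phi_inj; rewrite inE.
  - move=> r r' rt rt'; have [->|rr'] := eqVneq r r'.
      by rewrite !subrr; exact: close_refl.
    exists ((phi r - phi r') / (r - r')); split; first exact: phi_close.
    by rewrite mulrC divfK // subr_eq0.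
exists (fun t n => torsion_map vbar E1 E2 phi (iota u) (t n)); split.
- exact: torsion_map_tate2_bij.
- move=> s t ss tt; apply/funext => n.
  by apply: (torsion_map_add match12 val2); exact: tate2_tors.
- move=> a t _ tt; apply/funext => n.
  by apply: (torsion_map_mul match12 val2); exact: tate2_tors.
- move=> sigma t sigma_gal tt; apply/funext => n.
  have tn := tate2_tors n tt; have [tn' sn] := torsion_mapP match12 val2 tn.
  (* By uniqueness it suffices that the conjugate of the match is matched with the conjugate
     point. *)
  apply: (torsion_map_eq match12 val2).
  + exact: ec_tors_galois.
  + exact: ec_tors_galois.
  + apply: (sim_galois v_complete) => //.
    * by move=> r; exact: phi_equiv.
    * by rewrite (proj2 sigma_gal).
Qed.
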